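(* The zero locus in $OG(5,10)_-$ of a general global section of the spinor bundle $\mathcal{S}_+$ is isomorphic to the smooth five-dimensional quadric $\mathbb{Q}^5$.
   Context: Over $\mathbb{C}$. Let $V=\mathbb{C}^{10}=E\oplus F$ carry a non-degenerate quadratic form, with $E,F$ maximal isotropic, $F\simeq E^\vee$. The half-spin representations of $Spin_{10}$ are $\Delta_+=\wedge^{even}E$, $\Delta_-=\wedge^{odd}E$. The variety of maximal isotropic subspaces of $V$ has two components $OG(5,10)_\pm$, embedded respectively in $\mathbb{P}(\Delta_\pm)$. On $OG(5,10)_-$, the spinor bundle $\mathcal{S}_+$ is the irreducible homogeneous bundle of rank $5$ with $H^0(\mathcal{S}_+)=\Delta_+$, namely $\mathcal{S}_+=\mathcal{U}\otimes\mathcal{O}(1)$, where $\mathcal{U}$ is the tautological rank $5$ bundle and $\mathcal{O}(1)$ the hyperplane bundle of the embedding in $\mathbb{P}(\Delta_-)$; its determinant is $\mathcal{O}(3)$. *)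

(* Defs.v *)
From HB Require Import structures.
From mathcomp Require Import all_boot all_order all_algebra.
From mathcomp Require Import classical_sets functions reals.
From mathcomp Require Import complex mpoly ring.

Set Implicit Arguments.
Unset Strict Implicit.
Unset Printing Implicit Defensive.

Import Order.TTheory GRing.Theory Num.Theory.

Local Open Scope ring_scope.
Local Open Scope classical_set_scope.

(* Projective C-schemes are handled through their functors of points on
   commutative C-algebras: a closed subscheme of a Grassmannian (or projective
   space) of C^n sends A to a set of direct summands of the free module
   A^n = 'rV[A]_n.  By Yoneda's lemma, an isomorphism of C-schemes is the same
   thing as a natural bijection between such functors.  The zero ring is not a
   [comAlgType]; nothing is lost, since every scheme has exactly one point over
   it. *)

(* Direct summands are images of idempotents; the rank is the one at all points
   of Spec A, i.e. after any base change to a field. *)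
Definition is_summand (A : comNzRingType) (n r : nat) (M : set 'rV[A]_n) :=
  exists e : 'M[A]_n,
    [/\ e *m e = e,
        M = [set x | exists y, x = y *m e]
      & forall (K : fieldType) (f : {rmorphism A -> K}),
          \rank (map_mx f e) = r].

(* For a summand M, the B-span of f(M) is the base change of M along f. *)
Definition base_change (A B : comNzRingType) (f : {rmorphism A -> B}) (n : nat)
    (M : set 'rV[A]_n) : set 'rV[B]_n :=
  [set y | exists (k : nat) (b : 'I_k -> B) (m : 'I_k -> 'rV[A]_n),
     (forall i, M (m i)) /\ y = \sum_(i < k) b i *: map_mx f (m i)].

Definition point_functor (C : fieldType) (n : nat) :=
  forall A : comAlgType C, set (set 'rV[A]_n).

Definition isomorphic (C : fieldType) (m n : nat)
    (X : point_functor C m) (Y : point_functor C n) :=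
  exists F : forall A : comAlgType C, set 'rV[A]_m -> set 'rV[A]_n,
    (forall A, set_bij (X A) (Y A) (F A)) /\
    (forall (A B : comAlgType C) (f : {lrmorphism A -> B}) M, X A M ->
       F B (base_change f M) = base_change f (F A M)).

Section Spinors.
Variable A : comNzRingType.

(* V = E (+) F with E = A^5 (first five coordinates, basis e_i) and F = E^vee
   (last five coordinates, dual basis f_i), with q(x + y) = <y, x>. *)
Local Notation V := 'rV[A]_(5 + 5).

Definition quadV (v : V) : A :=
  \sum_(i < 5) v 0 (lshift 5 i) * v 0 (rshift 5 i).

Definition polarV (v w : V) : A := quadV (v + w) - quadV v - quadV w.

(* The exterior algebra of E, in the basis e_S = e_{i_1} /\ ... /\ e_{i_k},
   S = {i_1 < ... < i_k}; the coordinate on e_S has index [enum_rank S]. *)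
Definition spinor := 'rV[A]_#|{: {set 'I_5}}|.

Definition spcoord (x : spinor) (S : {set 'I_5}) : A := x 0 (enum_rank S).

Definition mkspinor (c : {set 'I_5} -> A) : spinor := \row_k c (enum_val k).

Definition even_spinor (x : spinor) :=
  forall S : {set 'I_5}, odd #|S| -> spcoord x S = 0.

Definition odd_spinor (x : spinor) :=
  forall S : {set 'I_5}, ~~ odd #|S| -> spcoord x S = 0.

Definition sgn_at (i : 'I_5) (S : {set 'I_5}) : A :=
  (-1) ^+ #|[set j in S | (j < i)%N]|.

(* x |-> e_i /\ x *)
Definition wedge (i : 'I_5) (x : spinor) : spinor :=
  mkspinor (fun S => if i \in S then sgn_at i S * spcoord x (S :\ i) else 0).

(* contraction of x by f_i *)
Definition contract (i : 'I_5) (x : spinor) : spinor :=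
  mkspinor (fun S => if i \in S then 0 else sgn_at i S * spcoord x (i |: S)).

Definition clifford (v : V) (x : spinor) : spinor :=
  \sum_(i < 5) (v 0 (lshift 5 i) *: wedge i x + v 0 (rshift 5 i) *: contract i x).

(* Linear forms on the exterior algebra are written in the dual basis. *)
Definition pairing (phi x : spinor) : A := (phi *m x^T) 0 0.

(* The fibre of O(-1) at U: P(Delta_-) is the space of hyperplanes of Delta_-,
   i.e. of lines in Delta_-^vee, so that H^0(O(1)) = Delta_- and
   H^0(U (x) O(1)) = Delta_+.  The point of P(Delta_-) attached to U is the line
   of linear forms on Delta_- that vanish on U . Delta_+. *)
Definition spinor_line (U : set V) : set spinor :=
  [set phi | odd_spinor phi /\
     forall u x, U u -> even_spinor x -> pairing phi (clifford u x) = 0].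

(* The component is singled out by its embedding in P(Delta_-): it contains the
   U for which O(-1) is a line subbundle of Delta_-^vee.  If U is in the other
   component, then [spinor_line U] is 0 over a field. *)
Definition OGminus : set (set V) :=
  [set U | [/\ is_summand 5 U,
               (forall u, U u -> quadV u = 0)
             & is_summand 1 (spinor_line U)]].

(* U (x) O(1) = Hom(O(-1), U); the section defined by s in Delta_+ sends phi in
   [spinor_line U] to the vector w with polarV w v = phi (v . s) for all v,
   which lies in U because it is orthogonal to U. *)
Definition spinor_section (s phi : spinor) : V :=
  row_mx (\row_i pairing phi (contract i s)) (\row_i pairing phi (wedge i s)).

End Spinors.

Section CliffordRelation.
Variable A : comNzRingType.
Implicit Types (x y : spinor A) (S : {set 'I_5}) (i j : 'I_5).

Let toggle i S : {set 'I_5} := if i \in S then S :\ i else i |: S.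

Let cliff1 i (b : bool) x := if b then wedge i x else contract i x.

Lemma spcoord_mk (c : {set 'I_5} -> A) S : spcoord (mkspinor c) S = c S.
Proof. by rewrite /spcoord mxE enum_rankK. Qed.

Lemma spinorP x y : (forall S, spcoord x S = spcoord y S) -> x = y.
Proof.
move=> xy; apply/rowP => k.
by have := xy (enum_val k); rewrite /spcoord enum_valK.
Qed.

Let in_toggle i j S : (j \in toggle i S) = (i == j) (+) (j \in S).
Proof.
rewrite /toggle; case: ifP => iS; rewrite !inE (eq_sym j);
  by case: eqP => [<-|]; rewrite ?iS.
Qed.

Let toggleC i j S : toggle i (toggle j S) = toggle j (toggle i S).
Proof. by apply/setP => k; rewrite !in_toggle addbCA. Qed.

Let toggleK i S : toggle i (toggle i S) = S.
Proof. by apply/setP => k; rewrite !in_toggle addKb. Qed.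

Let sgn_toggle i j S : sgn_at A i (toggle j S) = (-1) ^+ (j < i)%N * sgn_at A i S.
Proof.
have sgnD (T : {set 'I_5}) : j \in T ->
    sgn_at A i T = (-1) ^+ (j < i)%N * sgn_at A i (T :\ j).
  move=> jT; rewrite /sgn_at (cardsD1 j) inE jT /= exprD; congr (_ * (-1) ^+ _).
  by apply: eq_card => k; rewrite !inE andbA.
rewrite /toggle; case: ifP => jS; first by rewrite (sgnD S) // signrMK.
rewrite (sgnD (j |: S)) ?setU11 //; congr (_ * sgn_at A _ _).
by rewrite setU1K ?jS.
Qed.

Let cliff1E i b x S :
  spcoord (cliff1 i b x) S =
    ((i \in S) == b)%:R * (sgn_at A i S * spcoord x (toggle i S)).
Proof.
by rewrite /cliff1 /toggle; case: b; rewrite spcoord_mk; case: (i \in S);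
  rewrite /= ?mul1r ?mul0r.
Qed.

Let cliff1_anti i j a b x : i != j ->
  cliff1 i a (cliff1 j b x) = - cliff1 j b (cliff1 i a x).
Proof.
move=> ij; apply: spinorP => S; rewrite {2}/spcoord mxE -/(spcoord _ _).
rewrite !cliff1E !sgn_toggle !in_toggle (eq_sym j) (negPf ij) /=.
rewrite toggleC; have: (j < i)%N = ~~ (i < j)%N.
  by move: ij; rewrite -val_eqE /=; case: ltngtP.
move=> ->; rewrite signrN.
move: (_%:R : A) (_%:R : A) (sgn_at _ _ _) (sgn_at _ _ _) (_ ^+ _) (spcoord _ _).
by move=> c d s t u z; ring.
Qed.

Let sgn_sq i S : sgn_at A i S * sgn_at A i S = 1.
Proof. by rewrite /sgn_at -expr2 sqrr_sign. Qed.

Let cliff1_same i b x : cliff1 i b (cliff1 i b x) = 0.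
Proof.
apply: spinorP => S; rewrite !cliff1E in_toggle eqxx /= {2}/spcoord mxE.
by case: b; case: (i \in S); rewrite ?(mul0r, mulr0).
Qed.

Let cliff1_opp i x :
  cliff1 i true (cliff1 i false x) + cliff1 i false (cliff1 i true x) = x.
Proof.
apply: spinorP => S; rewrite {1}/spcoord mxE -!/(spcoord _ _).
rewrite !cliff1E in_toggle eqxx toggleK sgn_toggle ltnn expr0 mul1r.
case: (i \in S); rewrite /= ?(mul0r, mulr0, mul1r) ?addr0 ?add0r;
  by rewrite mulrA sgn_sq mul1r.
Qed.

Let coef (v : 'rV[A]_(5 + 5)) i (b : bool) :=
  if b then v 0 (lshift 5 i) else v 0 (rshift 5 i).

Let cliff1_is_linear i b a x y :
  cliff1 i b (a *: x + y) = a *: cliff1 i b x + cliff1 i b y.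
Proof.
apply: spinorP => S; rewrite cliff1E {2}/spcoord !mxE -!/(spcoord _ _) !cliff1E.
by rewrite /spcoord !mxE -!/(spcoord _ _); ring.
Qed.

Let cliff1D i b x y : cliff1 i b (x + y) = cliff1 i b x + cliff1 i b y.
Proof. by have := cliff1_is_linear i b 1 x y; rewrite !scale1r. Qed.

Let cliff1_0 i b : cliff1 i b 0 = 0.
Proof. by apply: (addrI (cliff1 i b 0)); rewrite -cliff1D !addr0. Qed.

Let cliff1Z i b a x : cliff1 i b (a *: x) = a *: cliff1 i b x.
Proof. by have := cliff1_is_linear i b a x 0; rewrite cliff1_0 !addr0. Qed.

Let cliffordE v x :
  clifford v x = \sum_(i < 5) \sum_(b : bool) coef v i b *: cliff1 i b x.
Proof. by apply: eq_bigr => i _; rewrite big_bool. Qed.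

Lemma clifford_sq (v : 'rV[A]_(5 + 5)) x :
  clifford v (clifford v x) = quadV v *: x.
Proof.
pose G i j := \sum_(a : bool) \sum_(b : bool)
  (coef v i a * coef v j b) *: cliff1 i a (cliff1 j b x).
have GN i j : i != j -> G i j = - G j i.
  move=> ij; rewrite /G exchange_big -sumrN; apply: eq_bigr => b _.
  rewrite -sumrN; apply: eq_bigr => a _.
  by rewrite cliff1_anti // scalerN mulrC.
have GE i : G i i = (coef v i true * coef v i false) *: x.
  rewrite /G !big_bool !cliff1_same !scaler0.
  rewrite -[LHS]/((0 + _) + (_ + 0)) addr0 add0r.
  by rewrite [coef v i false * _]mulrC -scalerDr cliff1_opp.
have -> : clifford v (clifford v x) = \sum_i \sum_j G i j.
  rewrite cliffordE; apply: eq_bigr => i _; rewrite [RHS]exchange_big.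
  apply: eq_bigr => a _.
  rewrite cliffordE (big_morph _ (cliff1D i a) (cliff1_0 i a)) scaler_sumr.
  apply: eq_bigr => j _.
  rewrite (big_morph _ (cliff1D i a) (cliff1_0 i a)) scaler_sumr.
  by apply: eq_bigr => b _; rewrite cliff1Z scalerA.
have -> : \sum_i \sum_j G i j = \sum_i G i i +
    (\sum_(i < 5) \sum_(j < 5 | (j < i)%N) G i j +
     \sum_(i < 5) \sum_(j < 5 | (i < j)%N) G i j).
  rewrite -!big_split; apply: eq_bigr => i _; rewrite (bigD1 i) //=; congr (_ + _).
  rewrite (bigID (fun j : 'I_5 => (j < i)%N)) /=.
  by congr (_ + _); apply: eq_bigl => j; rewrite -val_eqE /=; case: ltngtP.
rewrite [X in _ + (X + _)](exchange_big_dep xpredT) //= -big_split /= [X in _ + X]big1 ?addr0.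
  by rewrite /quadV scaler_suml; apply: eq_bigr => i _; rewrite GE.
move=> j _; rewrite -big_split big1 //= => i ij.
by rewrite GN ?addNr // -val_eqE /=; case: ltngtP ij.
Qed.

Let pairingD (phi : spinor A) x y : pairing phi (x + y) = pairing phi x + pairing phi y.
Proof. by rewrite /pairing linearD mulmxDr mxE. Qed.

Let pairingZ (phi : spinor A) a x : pairing phi (a *: x) = a * pairing phi x.
Proof. by rewrite /pairing linearZ -scalemxAr mxE. Qed.

Let pairing0 (phi : spinor A) : pairing phi (0 : spinor A) = 0.
Proof. by rewrite /pairing linear0 mulmx0 mxE. Qed.

Lemma spinor_sectionP (s phi : spinor A) (v : 'rV[A]_(5 + 5)) :
  polarV (spinor_section s phi) v = pairing phi (clifford v s).
Proof.
rewrite /polarV /quadV (big_morph _ (pairingD phi) (pairing0 phi)) -!sumrB.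
apply: eq_bigr => i _; rewrite pairingD !pairingZ /spinor_section.
by rewrite ![(_ + v) _ _]mxE !row_mxEl !row_mxEr ![(\row__ _) _ _]mxE; ring.
Qed.
End CliffordRelation.

Definition zero_locus (C : fieldType) (s : spinor C) : point_functor C (5 + 5) :=
  fun A => [set U | OGminus U /\
    forall phi, spinor_line U phi ->
      spinor_section (map_mx (in_alg A) s) phi = 0].

(* P holds on a nonempty Zariski open subset of Delta_+.  Every polynomial
   function on Delta_+ is the restriction of some p, and the nonvanishing loci
   of such functions form a basis of open subsets. *)
Definition general_even_spinor (C : fieldType) (P : spinor C -> Prop) :=
  exists p : {mpoly C[#|{: {set 'I_5}}|]},
    (exists2 s : spinor C, even_spinor s & p.@[fun k => s 0 k] != 0) /\
    (forall s : spinor C, even_spinor s -> p.@[fun k => s 0 k] != 0 -> P s).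

Definition qform (A : comNzRingType) (n : nat) (G : 'M[A]_n) (x : 'rV[A]_n) : A :=
  (x *m G *m x^T) 0 0.

(* Jacobian criterion: for G symmetric, the gradient of [qform G] at x is
   2 x G. *)
Definition smooth_quadric (C : fieldType) (n : nat) (G : 'M[C]_n) :=
  G^T = G /\ forall x : 'rV[C]_n, x != 0 -> qform G x = 0 -> x *m G != 0.

(* The quadric hypersurface qform G = 0 in the projective space of lines in
   C^n, of dimension n - 2. *)
Definition quadric (C : fieldType) (n : nat) (G : 'M[C]_n) : point_functor C n :=
  fun A => [set L | is_summand 1 L /\
    forall x, L x -> qform (map_mx (in_alg A) G) x = 0].

(* Main.v *)
(* A point U of OG corresponds to the line of forms phi on Delta_- that vanish on
   U . Delta_+. Over any algebra, the Clifford relations make phi (psi) v the value at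
   phi of the section v . psi for v in U, which recovers U from the line; a Fierz
   identity recovers the line from U. The section s vanishes at U when phi vanishes on
   V . s. Up to transvections 1 + u w of the Clifford algebra, with u and w spanning an
   isotropic plane, a general s is a + c e_1 /\ e_2 /\ e_3 /\ e_4. Then the forms that
   vanish on V . s make up a space of dimension 7, on which the quadratic equations of
   pure spinors reduce to a single nondegenerate one, and all nondegenerate quadratic
   forms in seven variables over C are equivalent. *)

From HB Require Import structures.
Require Import Defs.
From mathcomp Require Import all_boot all_order all_algebra.
From mathcomp Require Import ring_quotient boolp classical_sets reals.
From mathcomp Require Import complex mpoly ring zify.

Set Implicit Arguments.
Unset Strict Implicit.
Unset Printing Implicit Defensive.

Import Order.TTheory GRing.Theory Num.Theory.

Local Open Scope ring_scope.
Local Open Scope classical_set_scope.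

(** Points are taken over arbitrary C-algebras A, possibly with nilpotents, while ranks are
    prescribed only at field points. The bridge is that a matrix which is idempotent up to a unit
    and vanishes at every field point is 0. A line need not have a generator: it is handled through
    an idempotent of trace 1, proportionality of phi and psi is written phi^T psi = psi^T phi, and
    division by a value phi (psi) is replaced by finitely many pairs (l_k, m_k) whose values l_k
    (m_k) sum to 1. Characteristic 0 serves to read ranks off traces and to divide by 2 and 4. For s
    in normal form the quadric comes from dimension 8: the forms that vanish on V . s live on the
    sets containing 5, which carry a half-spin representation of Spin_8 with its invariant quadratic
    form, and one linear relation cuts the eight coordinates down to seven. The order of elimination
    matters: e_i e_j removes coordinates of degree 2 at the price of changing degree 4, whereas e_5
    f_j, once degree 2 is gone, alters degree 4 alone. An invariant of the first kind of move
    guarantees that c is nonzero at the end. *)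

Local Notation N := #|{: {set 'I_5}}|.
Local Notation "M '%:A[' A ]" := (map_mx (in_alg A) M) (at level 2, format "M %:A[ A ]").
Local Notation o5 k := (@Ordinal 5 k isT).
Local Notation o7 k := (@Ordinal 7 k isT).

(** * Commutative rings and direct summands *)

Section MaximalIdeal.
Variables (A : comNzRingType) (M : set A).
Hypothesis addM : forall x y, M x -> M y -> M (x + y).
Hypothesis mulM : forall r x, M x -> M (r * x).
Hypothesis M0 : M 0.
Hypothesis M1 : ~ M 1.
Hypothesis maxM : forall x, ~ M x -> exists m r, M m /\ m + r * x = 1.

Definition ideal_pred : pred A := fun x => `[< M x >].

Fact ideal_pred_closed : idealr_closed ideal_pred.
Proof.
split; first exact/asboolP.
  by rewrite unfold_in /ideal_pred; apply/asboolP.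
by move=> r x y /asboolP Mx /asboolP My; apply/asboolP/addM => //; apply: mulM.
Qed.

Definition max_ideal : idealr A :=
  HB.pack ideal_pred (isIdealr.Build A ideal_pred ideal_pred_closed).

Local Notation residue := {ideal_quot max_ideal}.
Local Notation proj := (\pi_residue%qT).

Lemma residue_pi0 x : (proj x == 0 :> residue) = `[< M x >].
Proof.
have <- : proj 0%R = 0 :> residue by rewrite rmorph0.
by rewrite -Quotient.idealrBE subr0.
Qed.

Fact residue_invP (x : residue) :
  exists y, (x != 0 -> y * x = 1) /\ (x = 0 -> y = 0).
Proof.
have [->|x0] := eqVneq x 0; first by exists 0.
suff [y yx]: exists y, y * x = 1 by exists y; split=> // x00; rewrite x00 eqxx in x0.
move: x0; elim/quotW: x => x; rewrite residue_pi0 => /asboolPn/maxM [m [r [Mm E]]].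
exists (proj r); rewrite -rmorphM /=.
apply/eqP; rewrite -subr_eq0 -(rmorph1 proj) -rmorphB residue_pi0.
apply/asboolP; rewrite -E opprD addrA addrAC subrr add0r -mulN1r.
exact: mulM.
Qed.

Definition residue_inv (x : residue) : residue := sval (cid (residue_invP x)).

Fact residue_mulVf x : x != 0 -> residue_inv x * x = 1.
Proof. by have [+ _] := svalP (cid (residue_invP x)); apply. Qed.

Fact residue_invr0 : residue_inv 0 = 0.
Proof. by have [_] := svalP (cid (residue_invP 0)); apply. Qed.

Definition residue_field : fieldType :=
  HB.pack residue (GRing.ComNzRing_isField.Build residue residue_mulVf residue_invr0).

Lemma residue_field_point : exists (K : fieldType) (f : {rmorphism A -> K}),
  forall x, M x -> f x = 0.
Proof.
exists residue_field, (proj : {rmorphism A -> residue}) => x Mx.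
by apply/eqP; rewrite residue_pi0; apply/asboolP.
Qed.
End MaximalIdeal.

Lemma nonunit_field_point (A : comNzRingType) (a : A) :
  (forall b, b * a != 1) ->
  exists (K : fieldType) (f : {rmorphism A -> K}), f a = 0.
Proof.
move=> a_nunit.
(* Zorn's lemma, on the [X] for which the ideal generated by [X] and [a] is proper. *)
pose P (X : set A) := [/\ forall x y, X x -> X y -> X (x + y),
   forall r x, X x -> X (r * x) & forall x r, X x -> x + r * a != 1].
have [F FP Ftot|M [[addM mulM aM] maxM]] := @Zorn_bigcup A P.
  split=> [x y [X FX Xx] [Y FY Yy]|r x [X FX Xx]|x r [X FX Xx]].
  - have [XY|YX] := Ftot _ _ FX FY.
      by exists Y => //; have [+ _ _] := FP _ FY; apply=> //; apply: XY.
    by exists X => //; have [+ _ _] := FP _ FX; apply=> //; apply: YX.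
  - by exists X => //; have [_ + _] := FP _ FX; apply.
  - by have [_ _] := FP _ FX; apply.
(* By maximality M absorbs M + (a). The case [m = 0] is kept apart because the family contains the
   empty set, the union of the empty chain, so M is not yet known to contain 0. *)
have Ma : M a.
  apply: contrapT => nMa.
  apply: (maxM [set y | exists m r, (M m \/ m = 0) /\ y = m + r * a]).
    split=> [m Mm|H]; first by exists m, 0; rewrite mul0r addr0; split=> //; left.
    by apply/nMa/H; exists 0, 1; rewrite add0r mul1r; split=> //; right.
  have M0D m m' : M m \/ m = 0 -> M m' \/ m' = 0 -> M (m + m') \/ m + m' = 0.
    case=> [Mm|->]; last by rewrite add0r.
    by case=> [Mm'|->]; left; [apply: addM|rewrite addr0].
  split=> [_ _ [m [r [Mm ->]]] [m' [r' [Mm' ->]]]|t _ [m [r [Mm ->]]]|_ t [m [r [Mm ->]]]].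
  - by exists (m + m'), (r + r'); rewrite mulrDl addrACA; split=> //; apply: M0D.
  - exists (t * m), (t * r); rewrite mulrDr mulrA; split=> //.
    by case: Mm => [/(mulM t)|->]; [left|rewrite mulr0; right].
  - by rewrite -addrA -mulrDl; case: Mm => [/aM|->] //; rewrite add0r.
have M0 : M 0 by rewrite -(mul0r a); apply: mulM.
have M1 : ~ M 1 by move=> /(aM _ 0) /eqP; rewrite mul0r addr0.
have [x nMx|K [f fM]] := residue_field_point addM mulM M0 M1.
  apply: contrapT => H.
  apply: (maxM [set y | exists m r, M m /\ y = m + r * x]).
    split=> [m Mm|yM]; first by exists m, 0; rewrite mul0r addr0.
    by apply/nMx/yM; exists 0, 1; rewrite add0r mul1r.
  split=> [_ _ [m [r [Mm ->]]] [m' [r' [Mm' ->]]]|t _ [m [r [Mm ->]]]|_ t [m [r [Mm ->]]]].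
  - by exists (m + m'), (r + r'); rewrite mulrDl addrACA; split=> //; apply: addM.
  - by exists (t * m), (t * r); rewrite mulrDr mulrA; split=> //; apply: mulM.
  - apply/eqP => E; apply: H; exists (m + t * a), r; split.
      by apply: addM => //; apply: mulM.
    by rewrite addrAC.
by exists K, f; apply: fM.
Qed.

(** A nonunit lies in a maximal ideal, hence dies in a residue field. This turns conditions at field
    points into identities over A. *)
Lemma unit_at_fields (A : comNzRingType) (a : A) :
  (forall (K : fieldType) (f : {rmorphism A -> K}), f a != 0) ->
  exists b, b * a = 1.
Proof.
move=> fa; apply: contrapT => na.
have [b|K [f /eqP]] := @nonunit_field_point A a; last by rewrite (negPf (fa K f)).
by apply/eqP => ba; apply: na; exists b.
Qed.

Definition rowim (A : comNzRingType) (n : nat) (e : 'M[A]_n) : set 'rV[A]_n :=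
  [set x | exists y, x = y *m e].

Section Idempotents.
Variable A : comNzRingType.

(* [f] has its entries in the Jacobson radical, so [c - f], which kills [f], is
   invertible. *)
Lemma scaled_idem_eq0 n (c : A) (f : 'M[A]_n) : f *m f = c *: f ->
  (forall (K : fieldType) (g : {rmorphism A -> K}), g c != 0) ->
  (forall (K : fieldType) (g : {rmorphism A -> K}), map_mx g f = 0) -> f = 0.
Proof.
move=> ff c0 f0.
have [K g|b bd] := @unit_at_fields A (\det (c%:M - f)).
  by rewrite -det_map_mx map_mxB f0 subr0 map_scalar_mx det_scalar expf_neq0 ?c0.
have : f *m (c%:M - f) *m \adj (c%:M - f) = 0.
  by rewrite mulmxBr ff mul_mx_scalar subrr mul0mx.
rewrite -mulmxA mul_mx_adj mul_mx_scalar => /(congr1 (fun M => b *: M)).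
by rewrite scalerA bd scale1r scaler0.
Qed.

Lemma scaled_idem_fin_eq0 (I : finType) (c : A) (F : I -> I -> A) :
  (forall i j, \sum_k F i k * F k j = c * F i j) ->
  (forall (K : fieldType) (g : {rmorphism A -> K}), g c != 0) ->
  (forall (K : fieldType) (g : {rmorphism A -> K}) i j, g (F i j) = 0) ->
  forall i j, F i j = 0.
Proof.
move=> FF c0 F0 i j.
pose f := \matrix_(i < #|I|, j < #|I|) F (enum_val i) (enum_val j).
suff: f = 0 by move/matrixP/(_ (enum_rank i) (enum_rank j)); rewrite !mxE !enum_rankK.
apply: (@scaled_idem_eq0 _ c) => // [|K g]; apply/matrixP => k l; rewrite !mxE //.
rewrite -FF [RHS](reindex _ (onW_bij _ (@enum_val_bij I))).
by apply: eq_bigr => m _; rewrite !mxE.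
Qed.

Lemma idem_fixes n (e : 'M[A]_n) x : e *m e = e -> rowim e x -> x *m e = x.
Proof. by move=> ee [y ->]; rewrite -mulmxA ee. Qed.

Lemma base_change_rowim (B : comNzRingType) (f : {rmorphism A -> B}) n (e : 'M[A]_n) :
  e *m e = e -> base_change f (rowim e) = rowim (map_mx f e).
Proof.
move=> ee; apply/seteqP; split=> [_ [k [b [m [em ->]]]]|_ [y ->]].
  exists (\sum_(i < k) b i *: map_mx f (m i)); rewrite mulmx_suml.
  apply: eq_bigr => i _; rewrite -scalemxAl -map_mxM idem_fixes //; exact: em.
exists n, (fun i => y 0 i), (fun i => row i e); split=> [i|].
  by exists (delta_mx 0 i); rewrite -rowE.
by rewrite mulmx_sum_row; apply: eq_bigr => i _; rewrite map_row.
Qed.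
End Idempotents.

(** In a rank factorization e = u v, idempotency forces v u = 1, and tr (u v) = tr (v u). *)
Lemma mxtrace_idem (K : fieldType) n (e : 'M[K]_n) :
  e *m e = e -> \tr e = (\rank e)%:R.
Proof.
move=> ee; have := mulmx_base e; move: (row_base_free e) (col_base_full e).
move: (row_base e) (col_base e) => v u vf uf uv.
have vu : v *m u = 1%:M.
  apply: (row_free_inj vf); apply: (row_full_inj uf).
  suff: u *m (v *m u *m v) = u *m (1%:M *m v) by [].
  by rewrite mul1mx !mulmxA uv -mulmxA uv ee.
by rewrite -{1}uv mxtrace_mulC vu mxtrace1.
Qed.

Section Summands.
Variables (C : numFieldType) (A : comAlgType C).

(** The integer is already invertible in C, so its inverse has an image in K. *)
Lemma natr_field_neq0 (K : fieldType) (g : {rmorphism A -> K}) n : n.+1%:R != 0 :> K.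
Proof.
apply/eqP => n0; have /eqP[] := oner_neq0 K.
have -> : 1 = g (in_alg A n.+1%:R^-1) * n.+1%:R.
  by rewrite -(rmorph_nat g) -(rmorph_nat (in_alg A)) -!rmorphM mulVf ?rmorph1 ?pnatr_eq0.
by rewrite n0 mulr0.
Qed.

Lemma mulIn_alg n (a : A) : n.+1%:R * a = 0 -> a = 0.
Proof.
move=> na; have -> : a = in_alg A n.+1%:R^-1 * (n.+1%:R * a).
  by rewrite mulrA -(rmorph_nat (in_alg A)) -rmorphM mulVf ?pnatr_eq0 // rmorph1 mul1r.
by rewrite na mulr0.
Qed.

(** The trace commutes with base change, and in characteristic 0 it determines the rank of an
    idempotent at every field point. *)
Lemma is_summand_trace n r (e : 'M[A]_n) :
  e *m e = e -> \tr e = r%:R -> is_summand r (rowim e).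
Proof.
move=> ee tre; exists e; split=> // K f.
have: (\rank (map_mx f e))%:R = r%:R :> K.
  by rewrite -mxtrace_idem -?map_mxM ?ee // trace_map_mx tre rmorph_nat.
have ltK p q : (p < q)%N -> p%:R != q%:R :> K.
  move=> pq; rewrite -subr_eq0 -opprB oppr_eq0 -natrB 1?ltnW // -(subnK pq) addnS.
  by rewrite subSn ?leq_addl ?addnK // natr_field_neq0.
by case: (ltngtP (\rank (map_mx f e)) r) => // /ltK/eqP E eqr; case: E.
Qed.

(** The exterior square of L vanishes at all field points, hence over A: the 2 by 2 minors of e are
    0. The last clause says that any two elements of L are proportional, without naming a
    generator. *)
Lemma summand1P n (L : set 'rV[A]_n) : is_summand 1 L <->
  exists e : 'M[A]_n, [/\ e *m e = e, \tr e = 1, L = rowim e &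
    forall x y, L x -> L y -> x^T *m y = y^T *m x].
Proof.
split=> [[e [ee -> rke]]|[e [ee tre -> _]]]; last exact: is_summand_trace.
(* [F] is twice the projector of [A^n (x) A^n] onto the exterior square of [L]. *)
pose F (p q : 'I_n * 'I_n) := e p.1 q.1 * e p.2 q.2 - e p.1 q.2 * e p.2 q.1.
have eeE i j : \sum_k e i k * e k j = e i j by rewrite -[in RHS]ee mxE.
have F0 : forall p q, F p q = 0.
  apply: (@scaled_idem_fin_eq0 A _ 2 F) => [[i k] [j l]|K f|K f [i k] [j l]].
  - have D a b c d : \sum_(p : 'I_n * 'I_n) (e a p.1 * e p.1 b) * (e c p.2 * e p.2 d) =
        e a b * e c d.
      rewrite -(eeE a b) -(eeE c d) big_distrlr pair_bigA.
      by apply: eq_bigr => -[].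
    transitivity (\sum_(p : 'I_n * 'I_n)
      ((e i p.1 * e p.1 j) * (e k p.2 * e p.2 l) -
       (e i p.1 * e p.1 l) * (e k p.2 * e p.2 j) -
       ((e k p.1 * e p.1 j) * (e i p.2 * e p.2 l) -
       (e k p.1 * e p.1 l) * (e i p.2 * e p.2 j)))).
      by apply: eq_bigr => -[p q] _; rewrite /F /=; ring.
    by rewrite !sumrB !D /F /=; ring.
  - by rewrite rmorph_nat natr_field_neq0.
  - have [u [v uv]] : exists (u : 'M[K]_(n, 1)) (v : 'M[K]_(1, n)), map_mx f e = u *m v.
      move: (mulmx_base (map_mx f e)); move: (col_base _) (row_base _); rewrite rke.
      by move=> u v <-; exists u, v.
    have E a b : f (e a b) = u a 0 * v 0 b.
      by have := congr1 (fun M : 'M_n => M a b) uv; rewrite !mxE big_ord1.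
    by rewrite /F /= rmorphB !rmorphM !E; ring.
have e2 i j k l : e i j * e k l = e i l * e k j.
  by apply/eqP; rewrite -subr_eq0; apply/eqP/(F0 (i, k) (j, l)).
exists e; split=> // [|_ _ [x ->] [y ->]].
  (* The minors give (tr e)^2 = tr (e e) = tr e, and an idempotent that is a unit equals 1. *)
  have tt : \tr e * \tr e = \tr e.
    rewrite -{3}ee /mxtrace big_distrlr; apply: eq_bigr => i _ /=.
    by rewrite mxE; apply: eq_bigr => j _; rewrite e2.
  have [K f|b bt] := @unit_at_fields _ (\tr e).
    by rewrite -trace_map_mx mxtrace_idem -?map_mxM ?ee // rke oner_neq0.
  by rewrite -[LHS]mul1r -bt -mulrA tt.
apply/matrixP => i j; rewrite !mxE !big_ord1 !mxE !big_distrlr /= exchange_big.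
apply: eq_bigr => k _; apply: eq_bigr => l _.
by rewrite mulrACA (mulrC (x 0 l)) (mulrC (e l i)) e2; ring.
Qed.
End Summands.

(** * Symmetric bilinear forms *)

Section SymmetricForms.
Variable C : numClosedFieldType.

Lemma symmetric_form_eq0 n (H : 'M[C]_n) :
  H^T = H -> (forall x : 'rV_n, (x *m H *m x^T) 0 0 = 0) -> H = 0.
Proof.
move=> HT Hx; apply/matrixP => i j; rewrite [RHS]mxE.
have E k l : ((delta_mx 0 k : 'rV_n) *m H *m (delta_mx 0 l : 'rV_n)^T) 0 0 = H k l.
  by rewrite trmx_delta -rowE -colE 2!mxE.
have Hd k : H k k = 0 by rewrite -E Hx.
have D (a b : 'M[C]_1) : (a + b) 0 0 = a 0 0 + b 0 0 by rewrite mxE.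
have := Hx (delta_mx 0 i + delta_mx 0 j).
rewrite linearD /= mulmxDr !mulmxDl !D !E !Hd.
have -> : H j i = H i j by rewrite -{1}HT mxE.
by rewrite add0r addr0 => /eqP; rewrite -mulr2n mulrn_eq0 => /eqP.
Qed.

Lemma orthonormal_frame n (G : 'M[C]_n) k : G^T = G -> G \in unitmx -> (k <= n)%N ->
  exists M : 'M[C]_(k, n), M *m G *m M^T = 1%:M.
Proof.
move=> GT Gu; elim: k => [|k IHk] kn; first by exists 0; apply/matrixP => -[].
have [M MGM] := IHk (ltnW kn).
(* [p] projects onto the orthogonal complement of the rows of [M]. *)
pose p := 1%:M - G *m M^T *m M.
have pM : p *m (G *m M^T) = 0.
  by rewrite mulmxBl mul1mx -(mulmxA _ M) (mulmxA M) MGM mulmx1 subrr.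
(* If the form vanished on the complement, then p = 0, and 1 = G M^T M would have rank at most k <
   n. *)
have [x qx] : exists x : 'rV_n, (x *m (p *m G *m p^T) *m x^T) 0 0 != 0.
  apply: contrapT => H.
  have : p *m G *m p^T = 0.
    apply: symmetric_form_eq0 => [|x]; first by rewrite !trmx_mul trmxK GT mulmxA.
    by apply/eqP/negP => /negP Hx; apply: H; exists x.
  have pGp : p *m G *m p^T = p *m G.
    rewrite [p^T]linearB /= trmx1 mulmxBr mulmx1 trmx_mul mulmxA -(mulmxA p G) pM.
    by rewrite mul0mx subr0.
  rewrite pGp.
  move=> /(congr1 (mulmx^~ (invmx G))); rewrite mulmxK // mul0mx => /eqP.
  rewrite subr_eq0 => /eqP /(congr1 mxrank); rewrite mxrank1 => rk.
  have := leq_trans (mxrankM_maxr (G *m M^T) M) (rank_leq_row M).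
  by rewrite -rk leqNgt kn.
pose t := (x *m (p *m G *m p^T) *m x^T) 0 0.
pose y := (sqrtC t)^-1 *: (x *m p).
have yM : y *m G *m M^T = 0 by rewrite -mulmxA -scalemxAl -mulmxA pM mulmx0 scaler0.
have My : M *m G *m y^T = 0.
  by apply: trmx_inj; rewrite !trmx_mul trmxK GT mulmxA yM trmx0.
have yy : y *m G *m y^T = 1%:M.
  apply/matrixP => i j; rewrite !ord1 /y linearZ /= -!scalemxAl -scalemxAr scalerA !mxE eqxx.
  rewrite trmx_mul.
  have -> : \sum_j0 (x *m p *m G) 0 j0 * (p^T *m x^T) j0 0 = t.
    by rewrite /t !mulmxA -[_ *m _ *m x^T]mulmxA [RHS]mxE.
  by rewrite -expr2 exprVn sqrtCK mulVf.
suff E : col_mx y M *m G *m (col_mx y M)^T = 1%:M by exists (col_mx y M).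
rewrite mul_col_mx tr_col_mx mul_col_row yy yM My MGM.
by rewrite -scalar_mx_block.
Qed.

Lemma symmetric_congruent n (G H : 'M[C]_n) :
  G^T = G -> G \in unitmx -> H^T = H -> H \in unitmx ->
  exists2 P, P \in unitmx & P *m G *m P^T = H.
Proof.
move=> GT Gu HT Hu.
have [M MGM] := orthonormal_frame GT Gu (leqnn n).
have [L LHL] := orthonormal_frame HT Hu (leqnn n).
have uL : L \in unitmx by have := mulmx1_unit LHL; rewrite unitmx_mul => -[/andP[]].
have uM : M \in unitmx by have := mulmx1_unit MGM; rewrite unitmx_mul => -[/andP[]].
exists (invmx L *m M); first by rewrite unitmx_mul unitmx_inv uL.
rewrite trmx_mul !mulmxA -(mulmxA _ M G) -(mulmxA _ (M *m G)) MGM mulmx1.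
transitivity (invmx L *m (L *m H *m L^T) *m (invmx L)^T); first by rewrite LHL mulmx1.
by rewrite !mulmxA mulVmx // mul1mx -mulmxA -trmx_mul mulVmx // trmx1 mulmx1.
Qed.

Lemma smooth_quadric_unit n (G : 'M[C]_n) : smooth_quadric G -> G^T = G /\ G \in unitmx.
Proof.
move=> [GT Gx]; split=> //; rewrite -row_free_unit -kermx_eq0; apply: contraT.
move=> /rowV0Pn[x /sub_kermxP xG x0].
by have := Gx x x0; rewrite /qform xG mul0mx mxE eqxx => /(_ erefl).
Qed.
End SymmetricForms.

(** * Clifford action and annihilators *)

Section CliffordAlgebra.
Variable A : comNzRingType.
Local Notation V := 'rV[A]_(5 + 5).
Implicit Types (x y s phi psi : spinor A) (S T : {set 'I_5}) (u v w : V).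

Lemma spcoord_lin a x y S : spcoord (a *: x + y) S = a * spcoord x S + spcoord y S.
Proof. by rewrite /spcoord !mxE. Qed.

Lemma spcoordZ a x S : spcoord (a *: x) S = a * spcoord x S.
Proof. by rewrite /spcoord !mxE. Qed.

Lemma spcoord0 S : spcoord (0 : spinor A) S = 0.
Proof. by rewrite /spcoord mxE. Qed.

Lemma wedge_lin i a x y : wedge i (a *: x + y) = a *: wedge i x + wedge i y.
Proof.
apply: spinorP => S; rewrite spcoord_lin !spcoord_mk spcoord_lin.
by case: ifP => _; ring.
Qed.

Lemma contract_lin i a x y : contract i (a *: x + y) = a *: contract i x + contract i y.
Proof.
apply: spinorP => S; rewrite spcoord_lin !spcoord_mk spcoord_lin.
by case: ifP => _; ring.
Qed.

Lemma clifford_linr v a x y : clifford v (a *: x + y) = a *: clifford v x + clifford v y.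
Proof.
rewrite /clifford scaler_sumr -big_split; apply: eq_bigr => i _ /=.
rewrite wedge_lin contract_lin !scalerDr !scalerA ![a * _]mulrC -!addrA.
by congr (_ + _); rewrite addrCA.
Qed.

Lemma clifford_linl a u v x : clifford (a *: u + v) x = a *: clifford u x + clifford v x.
Proof.
rewrite /clifford scaler_sumr -big_split; apply: eq_bigr => i _ /=.
by rewrite !mxE !scalerDl scalerDr !scalerA addrACA.
Qed.

Lemma cliffordDr v x y : clifford v (x + y) = clifford v x + clifford v y.
Proof. by have := clifford_linr v 1 x y; rewrite !scale1r. Qed.

Lemma cliffordDl u v x : clifford (u + v) x = clifford u x + clifford v x.
Proof. by have := clifford_linl 1 u v x; rewrite !scale1r. Qed.

Lemma clifford0r v : clifford v 0 = 0.
Proof. by apply: (addrI (clifford v 0)); rewrite -cliffordDr !addr0. Qed.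

Lemma clifford0l x : clifford 0 x = 0.
Proof. by apply: (addrI (clifford 0 x)); rewrite -cliffordDl !addr0. Qed.

Lemma cliffordZr v a x : clifford v (a *: x) = a *: clifford v x.
Proof. by have := clifford_linr v a x 0; rewrite clifford0r !addr0. Qed.

Lemma cliffordZl a v x : clifford (a *: v) x = a *: clifford v x.
Proof. by have := clifford_linl a v 0 x; rewrite clifford0l !addr0. Qed.

Lemma cliffordNr v x : clifford v (- x) = - clifford v x.
Proof. by rewrite -scaleN1r cliffordZr scaleN1r. Qed.

Lemma clifford_sumr v (I : finType) (c : I -> A) (x : I -> spinor A) :
  clifford v (\sum_i c i *: x i) = \sum_i c i *: clifford v (x i).
Proof.
rewrite (big_morph _ (cliffordDr v) (clifford0r v)).
by apply: eq_bigr => i _; rewrite cliffordZr.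
Qed.

Lemma clifford_suml (I : finType) (c : I -> A) (v : I -> V) x :
  clifford (\sum_i c i *: v i) x = \sum_i c i *: clifford (v i) x.
Proof.
rewrite (big_morph (fun u => clifford u x) (fun u v => cliffordDl u v x) (clifford0l x)).
by apply: eq_bigr => i _; rewrite cliffordZl.
Qed.

Lemma pairingDr phi x y : pairing phi (x + y) = pairing phi x + pairing phi y.
Proof. by rewrite /pairing linearD mulmxDr mxE. Qed.

Lemma pairingZr phi a x : pairing phi (a *: x) = a * pairing phi x.
Proof. by rewrite /pairing linearZ -scalemxAr mxE. Qed.

Lemma pairing0r phi : pairing phi 0 = 0.
Proof. by rewrite -(scale0r 0) pairingZr mul0r. Qed.

Lemma pairingDl phi psi x : pairing (phi + psi) x = pairing phi x + pairing psi x.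
Proof. by rewrite /pairing mulmxDl mxE. Qed.

Lemma pairingZl a phi x : pairing (a *: phi) x = a * pairing phi x.
Proof. by rewrite /pairing -scalemxAl mxE. Qed.

Lemma pairing0l x : pairing (0 : spinor A) x = 0.
Proof. by rewrite -(scale0r 0) pairingZl mul0r. Qed.

Lemma pairingNr phi x : pairing phi (- x) = - pairing phi x.
Proof. by rewrite -scaleN1r pairingZr mulN1r. Qed.

Lemma pairing_sumr phi (I : finType) (c : I -> A) (x : I -> spinor A) :
  pairing phi (\sum_i c i *: x i) = \sum_i c i * pairing phi (x i).
Proof.
rewrite (big_morph _ (pairingDr phi) (pairing0r phi)).
by apply: eq_bigr => i _; rewrite pairingZr.
Qed.

Lemma pairing_suml (I : finType) (c : I -> A) (phi : I -> spinor A) x :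
  pairing (\sum_i c i *: phi i) x = \sum_i c i * pairing (phi i) x.
Proof.
rewrite (big_morph (fun phi => pairing phi x) (fun p q => pairingDl p q x) (pairing0l x)).
by apply: eq_bigr => i _; rewrite pairingZl.
Qed.

Lemma pairingE phi x : pairing phi x = \sum_S spcoord phi S * spcoord x S.
Proof.
rewrite /pairing mxE (reindex _ (onW_bij _ (@enum_rank_bij _))).
by apply: eq_bigr => S _; rewrite !mxE.
Qed.

Definition spbasis S : spinor A := delta_mx 0 (enum_rank S).

Lemma spcoord_basis S T : spcoord (spbasis S) T = (S == T)%:R.
Proof.
by rewrite /spcoord mxE eqxx /= eq_sym (inj_eq enum_rank_inj).
Qed.

Lemma spinor_sum_basis x : x = \sum_S spcoord x S *: spbasis S.
Proof.
rewrite {1}(row_sum_delta x) (reindex _ (onW_bij _ (@enum_rank_bij _))).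
by apply: eq_bigr.
Qed.

Lemma pairing_basis phi S : pairing phi (spbasis S) = spcoord phi S.
Proof.
rewrite pairingE (bigD1 S) //= spcoord_basis eqxx mulr1 big1 ?addr0 // => T TS.
by rewrite spcoord_basis eq_sym (negPf TS) mulr0.
Qed.

Lemma even_basis S : ~~ odd #|S| -> even_spinor (spbasis S).
Proof.
by move=> eS T oT; rewrite spcoord_basis; case: eqP => // ST; rewrite ST oT in eS.
Qed.

Lemma odd_basis S : odd #|S| -> odd_spinor (spbasis S).
Proof.
by move=> oS T eT; rewrite spcoord_basis; case: eqP => // ST; rewrite -ST oS in eT.
Qed.

Lemma spcoord_clifford v x S : spcoord (clifford v x) S =
  \sum_(i < 5) (if i \in S then v 0 (lshift 5 i) * (sgn_at A i S * spcoord x (S :\ i))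
                else v 0 (rshift 5 i) * (sgn_at A i S * spcoord x (i |: S))).
Proof.
rewrite {1}/spcoord summxE; apply: eq_bigr => i _.
rewrite -/(spcoord _ _) spcoord_lin spcoordZ !spcoord_mk.
by case: ifP => _; rewrite ?(mulr0, addr0, add0r).
Qed.

Lemma clifford_parity (b : bool) v x :
  (forall S, odd #|S| = b -> spcoord x S = 0) ->
  forall S, odd #|S| = ~~ b -> spcoord (clifford v x) S = 0.
Proof.
move=> xb S Sb; rewrite spcoord_clifford big1 // => i _; case: ifP => iS.
  rewrite xb ?mulr0 //; move: Sb; rewrite (cardsD1 i) iS /=.
  by move=> /(congr1 negb); rewrite !negbK.
by rewrite xb ?mulr0 // cardsU1 iS /= Sb negbK.
Qed.

Lemma clifford_even v x : even_spinor x -> odd_spinor (clifford v x).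
Proof. by move=> ex S /negPf; apply: (@clifford_parity true). Qed.

Lemma clifford_odd v x : odd_spinor x -> even_spinor (clifford v x).
Proof. by move=> ox; apply: (@clifford_parity false) => S /negbT; apply: ox. Qed.

Lemma polarVE v w : polarV v w =
  \sum_(i < 5) (v 0 (lshift 5 i) * w 0 (rshift 5 i) + w 0 (lshift 5 i) * v 0 (rshift 5 i)).
Proof.
by rewrite /polarV /quadV -!sumrB; apply: eq_bigr => i _; rewrite !mxE; ring.
Qed.

Lemma polarVC v w : polarV v w = polarV w v.
Proof. by rewrite /polarV (addrC v) addrAC. Qed.

Lemma polarV_linl a u v w : polarV (a *: u + v) w = a * polarV u w + polarV v w.
Proof.
rewrite !polarVE mulr_sumr -big_split; apply: eq_bigr => i _ /=.
by rewrite !mxE; ring.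
Qed.

Lemma polarV_inj w w' : (forall v, polarV w v = polarV w' v) -> w = w'.
Proof.
have pl (z : V) i : polarV z (delta_mx 0 (lshift 5 i)) = z 0 (rshift 5 i).
  rewrite polarVE (bigD1 i) //= !mxE !eqxx eq_rlshift /= mulr0 mul1r add0r.
  rewrite big1 ?addr0 // => j ji; rewrite !mxE !eqxx eq_rlshift eq_lshift (negPf ji) /=.
  by rewrite mulr0 mul0r addr0.
have pr (z : V) i : polarV z (delta_mx 0 (rshift 5 i)) = z 0 (lshift 5 i).
  rewrite polarVE (bigD1 i) //= !mxE !eqxx eq_lrshift /= mulr1 mul0r addr0.
  rewrite big1 ?addr0 // => j ji; rewrite !mxE !eqxx eq_lrshift eq_rshift (negPf ji) /=.
  by rewrite mulr0 mul0r addr0.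
move=> E; apply/rowP => k; case: (splitP k) => j kj.
  have -> : k = lshift 5 j by apply/val_inj.
  by rewrite -!pr E.
have -> : k = rshift 5 j by apply/val_inj.
by rewrite -!pl E.
Qed.

Lemma clifford_polar u v x :
  clifford u (clifford v x) + clifford v (clifford u x) = polarV u v *: x.
Proof.
rewrite /polarV !scalerBl -!clifford_sq !(cliffordDl, cliffordDr).
set a := clifford u (clifford u x); set b := clifford v (clifford v x).
set c := clifford u (clifford v x); set d := clifford v (clifford u x).
by apply/rowP => k; rewrite !mxE; ring.
Qed.
End CliffordAlgebra.

Section Isotropic.
Variable A : comNzRingType.
Local Notation V := 'rV[A]_(5 + 5).

Definition gram : 'M[A]_(5 + 5) := block_mx 0 1%:M 1%:M 0.

Lemma polarV_gram (v w : V) : polarV v w = (v *m gram *m w^T) 0 0.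
Proof.
rewrite polarVE -[in RHS](hsubmxK v) -[in RHS](hsubmxK w) /gram mul_row_block.
rewrite !mulmx0 !mulmx1 add0r addr0.
rewrite tr_row_mx mul_row_col !mxE -big_split; apply: eq_bigr => i _ /=.
by rewrite !mxE [RHS]addrC [X in _ = _ + X]mulrC.
Qed.

Lemma gram_sq : gram *m gram = 1%:M.
Proof. by rewrite mulmx_block !mulmx0 !mul0mx !mulmx1 !add0r !addr0 -scalar_mx_block. Qed.

(** U lies in its orthogonal, and both have rank 5 at every field point; this equality has to be
    lifted to A. The lemma will place the values of sections in U. *)
Lemma lagrangian (U : set V) : is_summand 5 U -> (forall u, U u -> quadV u = 0) ->
  forall w, (forall u, U u -> polarV w u = 0) -> U w.
Proof.
move=> [e [ee UE rke]] qU w wU.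
have Ur i : U (row i e) by rewrite UE; exists (delta_mx 0 i); rewrite -rowE.
have UD u v : U u -> U v -> U (u + v).
  by rewrite UE => -[y ->] [z ->]; exists (y + z); rewrite mulmxDl.
(* [d] is the adjoint of [e]; [(1 - d)(1 - e)] is an idempotent that vanishes at
   all points because the rank of [1 - d] is 10 - 5. *)
pose d := gram *m e^T *m gram.
have ed : e *m d = 0.
  rewrite /d !mulmxA; suff -> : e *m gram *m e^T = 0 by rewrite mul0mx.
  apply/matrixP => i j; rewrite [RHS]mxE.
  have : polarV (row i e) (row j e) = 0 by rewrite /polarV !qU ?subrr //; apply: UD.
  rewrite polarV_gram => <-; rewrite -row_mul !mxE.
  by apply: eq_bigr => k _; rewrite !mxE.
have dd : d *m d = d.
  by rewrite /d !mulmxA -[_ *m gram *m gram]mulmxA gram_sq mulmx1 -[_ *m e^T *m e^T]mulmxA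
     -trmx_mul ee.
have wd : w *m d = 0.
  rewrite /d !mulmxA; suff -> : w *m gram *m e^T = 0 by rewrite mul0mx.
  apply/rowP => j; rewrite [RHS]mxE -(wU _ (Ur j)) polarV_gram.
  by rewrite !mxE; apply: eq_bigr => k _; rewrite !mxE.
suff g0 : (1%:M - d) *m (1%:M - e) = 0.
  have : w *m ((1%:M - d) *m (1%:M - e)) = 0 by rewrite g0 mulmx0.
  rewrite mulmxA [w *m (1%:M - d)]mulmxBr mulmx1 wd subr0 mulmxBr mulmx1 => /eqP.
  by rewrite subr_eq0 UE => /eqP ->; exists w.
apply: (@scaled_idem_eq0 _ _ 1) => [|K g|K g].
- have de : (1%:M - e) *m (1%:M - d) *m (1%:M - e) = (1%:M - d) *m (1%:M - e).
    have -> : (1%:M - e) *m (1%:M - d) = 1%:M - d - e.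
      by rewrite mulmxBl mul1mx [e *m _]mulmxBr mulmx1 ed subr0.
    by rewrite mulmxBl [e *m _]mulmxBr mulmx1 ee subrr subr0.
  rewrite scale1r mulmxA -[_ *m _ *m (1%:M - d)]mulmxA -mulmxA de mulmxA.
  by rewrite [(1%:M - d) *m (1%:M - d)]mulmxBl mul1mx [d *m _]mulmxBr mulmx1 dd subrr subr0.
- by rewrite rmorph1 oner_neq0.
- rewrite map_mxM !map_mxB !map_mx1.
  set e' := map_mx g e; set d' := map_mx g d.
  (* The image of e' lies in that of 1 - d', and the ranks make the two images equal. *)
  have ed' : e' *m (1%:M - d') = e' by rewrite mulmxBr mulmx1 -map_mxM ed map_mx0 subr0.
  apply/eqP; rewrite mulmxBr mulmx1 subr_eq0 eq_sym; apply/eqP.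
  suff /submxP[z ->] : (1%:M - d' <= e')%MS by rewrite -mulmxA -map_mxM ee.
  have led : (e' <= 1%:M - d')%MS by rewrite -ed' submxMl.
  rewrite -(geq_leqif (mxrank_leqif_sup led)) rke.
  have : (\rank d' + \rank (1%:M - d')%R <= 5 + 5)%N.
    by apply: mulmx0_rank_max; rewrite mulmxBr mulmx1 -map_mxM dd subrr.
  suff : (\rank e' <= \rank d')%N by rewrite rke; lia.
  rewrite -[\rank e']mxrank_tr.
  have -> : e'^T = map_mx g gram *m (d' *m map_mx g gram).
    by rewrite -!map_mxM /d !mulmxA gram_sq mul1mx -mulmxA gram_sq mulmx1 map_trmx.
  by apply: leq_trans (mxrankM_maxr _ _) (mxrankM_maxl _ _).
Qed.

Implicit Types (x y s phi psi : spinor A) (S T : {set 'I_5}) (u v w : V).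

Lemma polarVZl a v w : polarV (a *: v) w = a * polarV v w.
Proof. by rewrite !polarVE mulr_sumr; apply: eq_bigr => i _; rewrite !mxE; ring. Qed.

Lemma polarVDl u v w : polarV (u + v) w = polarV u w + polarV v w.
Proof. by have := polarV_linl 1 u v w; rewrite scale1r mul1r. Qed.

Lemma polarV0l w : polarV 0 w = 0.
Proof. by rewrite -(scale0r 0) polarVZl mul0r. Qed.

Lemma section_linl a s s' phi :
  spinor_section (a *: s + s') phi = a *: spinor_section s phi + spinor_section s' phi.
Proof.
apply: polarV_inj => v; rewrite polarV_linl !spinor_sectionP.
by rewrite clifford_linr pairingDr pairingZr.
Qed.

Lemma section_linr a s phi phi' :
  spinor_section s (a *: phi + phi') = a *: spinor_section s phi + spinor_section s phi'.
Proof.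
apply: polarV_inj => v; rewrite polarV_linl !spinor_sectionP.
by rewrite pairingDl pairingZl.
Qed.

(* phi (w v psi) + phi (v w psi) = polarV w v * phi psi, and the second term
   vanishes. *)
Lemma section_clifford v phi psi : odd_spinor psi ->
  (forall x, even_spinor x -> pairing phi (clifford v x) = 0) ->
  spinor_section (clifford v psi) phi = pairing phi psi *: v.
Proof.
move=> opsi phiv; apply: polarV_inj => w; rewrite spinor_sectionP.
rewrite polarVZl (polarVC v); have /(canRL (addrK _)) -> := clifford_polar w v psi.
rewrite pairingDr pairingZr pairingNr phiv ?subr0 1?mulrC //.
exact: clifford_odd.
Qed.

(** The inverse of [spinor_line]: see [annihilator_spinor_line] and [spinor_line_annihilator]. *)
Definition annihilator (L : set (spinor A)) : set V :=
  [set u | forall phi x, L phi -> even_spinor x -> pairing phi (clifford u x) = 0].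

(* By [spinor_sectionP] this is the quadratic equation of pure spinors, polarized. *)
Definition pure_spinors (L : set (spinor A)) := forall phi phi' s x, L phi -> L phi' ->
  even_spinor s -> even_spinor x -> pairing phi' (clifford (spinor_section s phi) x) = 0.

End Isotropic.

Section AnnihilatorAlgebra.
Variable A : comNzRingType.
Local Notation V := 'rV[A]_(5 + 5).
Implicit Types (phi psi : spinor A) (u v : V).

Lemma section_suml (I : finType) (c : I -> A) (s : I -> spinor A) phi :
  spinor_section (\sum_i c i *: s i) phi = \sum_i c i *: spinor_section (s i) phi.
Proof.
have D s1 s2 : spinor_section (s1 + s2) phi = spinor_section s1 phi + spinor_section s2 phi.
  by have := section_linl 1 s1 s2 phi; rewrite !scale1r.
have Z0 : spinor_section 0 phi = 0 by apply: (addrI (spinor_section 0 phi)); rewrite -D !addr0.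
rewrite (big_morph (fun s => spinor_section s phi) D Z0); apply: eq_bigr => i _.
by have := section_linl (c i) (s i) 0 phi; rewrite Z0 !addr0.
Qed.

Lemma annihilator_sum L (I : finType) (c : I -> A) (u : I -> V) :
  (forall i, annihilator L (u i)) -> annihilator L (\sum_i c i *: u i).
Proof.
move=> Lu phi x Lphi ex; rewrite clifford_suml pairing_sumr big1 // => i _.
by rewrite Lu ?mulr0.
Qed.

Lemma clifford_e i (x : spinor A) : clifford (delta_mx 0 (lshift 5 i)) x = wedge i x.
Proof.
rewrite /clifford (bigD1 i) //= !mxE !eqxx eq_rlshift /= scale1r scale0r addr0.
rewrite big1 ?addr0 // => j ji.
by rewrite !mxE eq_rlshift eq_lshift (negPf ji) /= !scale0r addr0.
Qed.

Lemma clifford_f i (x : spinor A) : clifford (delta_mx 0 (rshift 5 i)) x = contract i x.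
Proof.
rewrite /clifford (bigD1 i) //= !mxE !eqxx eq_lrshift /= scale1r scale0r add0r.
rewrite big1 ?addr0 // => j ji.
by rewrite !mxE eq_lrshift eq_rshift (negPf ji) /= !scale0r addr0.
Qed.

Lemma wedge_contract i (x : spinor A) : wedge i (contract i x) + contract i (wedge i x) = x.
Proof.
rewrite -!(clifford_e, clifford_f) clifford_polar polarVE (bigD1 i) //=.
rewrite !mxE !eqxx eq_lrshift eq_rlshift /= mulr1 mulr0 addr0.
rewrite big1 ?addr0 ?scale1r // => j ji.
by rewrite !mxE eq_lrshift eq_lshift (negPf ji) /= mul0r mul0r addr0.
Qed.

End AnnihilatorAlgebra.

Section Annihilator.
Variables (C : numFieldType) (A : comAlgType C) (L : set (spinor A)).
Hypotheses (sumL : is_summand 1 L) (oddL : L `<=` @odd_spinor A).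

(* The pairs [(l, m)] sum to 1 under the pairing: [L] is locally free and need
   not have a global generator. *)
Lemma line_trace : exists (l m : 'I_N -> spinor A),
  [/\ forall k, L (l k), forall k, odd_spinor (m k) &
      \sum_k pairing (l k) (m k) = 1].
Proof.
have [e [ee tre LE _]] := (summand1P L).1 sumL.
exists (fun k => row k e).
(* Row k of e paired with the basis vector of index k is a diagonal entry of e. For an even set this
   entry is 0 because L is odd, so 0 can be taken there and all [m k] are odd. *)
exists (fun k : 'I_N => if odd #|(enum_val k : {set 'I_5})| then delta_mx 0 k else 0).
have Lk k : L (row k e) by rewrite LE; exists (delta_mx 0 k); rewrite -rowE.
split=> // [k|].
  case: ifP => // ok; first by rewrite -[k]enum_valK; apply: odd_basis.
  by move=> S _; rewrite spcoord0.
rewrite -tre; apply: eq_bigr => k _; case: ifP => ok.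
  by rewrite -{2}[k]enum_valK pairing_basis /spcoord enum_valK mxE.
have := oddL (Lk k) (negbT ok); rewrite /spcoord enum_valK mxE => ->.
by rewrite pairing0r.
Qed.

(** Each q(u) l_k (m_k) equals l_k (u . u . m_k) = 0, and the l_k (m_k) sum to 1. *)
Lemma annihilator_isotropic u : annihilator L u -> quadV u = 0.
Proof.
have [l [m [Ll om lm]]] := line_trace => Lu.
rewrite -[LHS]mulr1 -lm mulr_sumr big1 // => k _.
by rewrite -pairingZr -clifford_sq Lu //; apply: clifford_odd.
Qed.

(** By [section_clifford], u is the sum over k of the values at l_k of the sections defined by u .
    m_k. *)
Lemma annihilator_reconstruct (U : set 'rV[A]_(5 + 5)) :
  (forall (I : finType) (c : I -> A) u, (forall i, U (u i)) -> U (\sum_(i : I) c i *: u i)) ->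
  (forall phi s, L phi -> even_spinor s -> U (spinor_section s phi)) ->
  annihilator L `<=` U.
Proof.
move=> Usum Usec u Lu; have [l [m [Ll om lm]]] := line_trace.
rewrite -[u]scale1r -lm scaler_suml.
rewrite (eq_bigr (fun k => 1 *: spinor_section (clifford u (m k)) (l k))).
  by apply: Usum => k; apply: Usec => //; apply: clifford_odd.
move=> k _; rewrite scale1r section_clifford //.
by move=> x ex; apply: Lu.
Qed.

Hypothesis pureL : pure_spinors L.

Lemma annihilator_summand : is_summand 5 (annihilator L).
Proof.
have [l [m [Ll om lm]]] := line_trace.
(* [g] is a projection onto the annihilator, of trace 5. *)
pose g v := \sum_k spinor_section (clifford v (m k)) (l k).
pose e : 'M[A]_(5 + 5) := \matrix_a g (delta_mx 0 a).
have ge v : v *m e = g v.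
  rewrite mulmx_sum_row {2}(row_sum_delta v) /g.
  under [RHS]eq_bigr do rewrite clifford_suml section_suml.
  by rewrite exchange_big /=; apply: eq_bigr => a _; rewrite rowK scaler_sumr.
have gL v : annihilator L (g v).
  rewrite /g; under eq_bigr do rewrite -[spinor_section _ _]scale1r.
  apply: annihilator_sum => k phi x Lphi ex; apply: pureL => //.
  exact: clifford_odd.
have Lg u : annihilator L u -> g u = u.
  move=> Lu; rewrite -[RHS]scale1r -lm scaler_suml; apply: eq_bigr => k _.
  by rewrite section_clifford // => x ex; apply: Lu.
have -> : annihilator L = rowim e.
  apply/seteqP; split=> [u Lu|_ [v ->]]; last by rewrite ge.
  by exists u; rewrite ge Lg.
apply: is_summand_trace.
  by apply/row_matrixP => a; rewrite row_mul ge Lg // rowK.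
rewrite /mxtrace big_split_ord /= -big_split /=.
(* For each i, the diagonal entries at e_i and f_i add up to the sum over k of l_k ((e_i f_i + f_i
   e_i) . m_k), which is 1. *)
have -> : 5%:R = \sum_(i < 5) \sum_k pairing (l k) (m k).
  by rewrite sumr_const card_ord lm.
apply: eq_bigr => i _; rewrite !mxE /g !summxE -big_split; apply: eq_bigr => k _ /=.
rewrite clifford_e clifford_f /spinor_section row_mxEl row_mxEr !mxE addrC.
by rewrite -pairingDr wedge_contract.
Qed.
End Annihilator.

(** * Fierz identity *)

Section FierzBits.
Variables (A : comNzRingType) (f g : bool -> bool -> bool -> bool -> bool -> A).

(* Five bits encode a subset of ['I_5]. For the spinors with coordinates [f] and
   [g], this is g (w . e_T), where [w] is the value at [f] of the section defined by
   [e_P]: see [clifford_section_bits]. *)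
Definition clifford_form p0 p1 p2 p3 p4 t0 t1 t2 t3 t4 : A :=
  (if p0 (+) t0 then f (~~ p0) p1 p2 p3 p4 * g (~~ t0) t1 t2 t3 t4 else 0) +
  (if p1 (+) t1 then (-1) ^+ (p0 (+) t0) *
     (f p0 (~~ p1) p2 p3 p4 * g t0 (~~ t1) t2 t3 t4) else 0) +
  (if p2 (+) t2 then (-1) ^+ ((p0 (+) t0) (+) (p1 (+) t1)) *
     (f p0 p1 (~~ p2) p3 p4 * g t0 t1 (~~ t2) t3 t4) else 0) +
  (if p3 (+) t3 then (-1) ^+ ((p0 (+) t0) (+) (p1 (+) t1) (+) (p2 (+) t2)) *
     (f p0 p1 p2 (~~ p3) p4 * g t0 t1 t2 (~~ t3) t4) else 0) +
  (if p4 (+) t4 then (-1) ^+ ((p0 (+) t0) (+) (p1 (+) t1) (+) (p2 (+) t2) (+) (p3 (+) t3)) *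
     (f p0 p1 p2 p3 (~~ p4) * g t0 t1 t2 t3 (~~ t4)) else 0).

Definition odd_bits p0 p1 p2 p3 p4 := p0 (+) p1 (+) p2 (+) p3 (+) p4.

Let alt p0 p1 p2 p3 p4 t0 t1 t2 t3 t4 :=
  clifford_form p0 p1 p2 p3 p4 t0 t1 t2 t3 t4 - clifford_form t0 t1 t2 t3 t4 p0 p1 p2 p3 p4.

(* The exterior square of a half-spin representation is the third exterior power of
   V; it occurs in [clifford_form], from which the antisymmetric part of the tensor
   product of [f] and [g] is therefore recovered. *)
Lemma fierz_identity p0 p1 p2 p3 p4 d0 d1 d2 d3 d4 :
  let t0 := p0 (+) d0 in let t1 := p1 (+) d1 in let t2 := p2 (+) d2 in
  let t3 := p3 (+) d3 in let t4 := p4 (+) d4 in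
  d0 || d1 || d2 || d3 || d4 -> ~~ odd_bits d0 d1 d2 d3 d4 ->
  4 * (f p0 p1 p2 p3 p4 * g t0 t1 t2 t3 t4 - f t0 t1 t2 t3 t4 * g p0 p1 p2 p3 p4) =
  (if d0 then alt (~~ p0) p1 p2 p3 p4 (~~ t0) t1 t2 t3 t4 else 0) +
  (if d1 then (-1) ^+ d0 * alt p0 (~~ p1) p2 p3 p4 t0 (~~ t1) t2 t3 t4 else 0) +
  (if d2 then (-1) ^+ (d0 (+) d1) * alt p0 p1 (~~ p2) p3 p4 t0 t1 (~~ t2) t3 t4 else 0) +
  (if d3 then (-1) ^+ (d0 (+) d1 (+) d2) *
     alt p0 p1 p2 (~~ p3) p4 t0 t1 t2 (~~ t3) t4 else 0) +
  (if d4 then (-1) ^+ (d0 (+) d1 (+) d2 (+) d3) *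
     alt p0 p1 p2 p3 (~~ p4) t0 t1 t2 t3 (~~ t4) else 0).
Proof.
(* Expanding [alt] flips two positions i, j of d in both indices. The terms with i = j give |d|
   copies of the difference on the left. For |d| = 2 the other terms supply two more copies; for |d|
   = 4 they cancel in complementary pairs. Hence the factor 4 in both cases. Signs depend only on d,
   so p stays generic. *)
rewrite /alt /clifford_form => /=.
case: d0; case: d1; case: d2; case: d3; case: d4 => // _ _;
  rewrite ?(addbT, addbF, addbN, addNb, addbb, negbK) /= ?(expr0, expr1); ring.
Qed.

Lemma fierz_bits p0 p1 p2 p3 p4 t0 t1 t2 t3 t4 :
  (forall a : A, 4 * a = 0 -> a = 0) ->
  (forall p0 p1 p2 p3 p4 t0 t1 t2 t3 t4, ~~ odd_bits p0 p1 p2 p3 p4 ->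
     ~~ odd_bits t0 t1 t2 t3 t4 -> clifford_form p0 p1 p2 p3 p4 t0 t1 t2 t3 t4 = 0) ->
  odd_bits p0 p1 p2 p3 p4 -> odd_bits t0 t1 t2 t3 t4 ->
  f p0 p1 p2 p3 p4 * g t0 t1 t2 t3 t4 = f t0 t1 t2 t3 t4 * g p0 p1 p2 p3 p4.
Proof.
move=> inj4 fg0 op ot; apply/eqP; rewrite -subr_eq0; apply/eqP/inj4.
pose d0 := p0 (+) t0; pose d1 := p1 (+) t1; pose d2 := p2 (+) t2.
pose d3 := p3 (+) t3; pose d4 := p4 (+) t4.
have [d|] := boolP (d0 || d1 || d2 || d3 || d4); last first.
  rewrite !negb_or -!andbA => /and5P[].
  by do 5! rewrite negb_add => /eqP ->; rewrite subrr mulr0.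
have od : ~~ odd_bits d0 d1 d2 d3 d4.
  rewrite /d0 /d1 /d2 /d3 /d4; move: op ot; rewrite /odd_bits.
  by case: (p0) (p1) (p2) (p3) (p4) (t0) (t1) (t2) (t3) (t4) => [] [] [] [] [] [] [] [] [] [].
have := fierz_identity p0 p1 p2 p3 p4 d od; rewrite /d0 /d1 /d2 /d3 /d4 /= !addKb => ->.
have alt0 q0 q1 q2 q3 q4 s0 s1 s2 s3 s4 : ~~ odd_bits q0 q1 q2 q3 q4 ->
    ~~ odd_bits s0 s1 s2 s3 s4 -> alt q0 q1 q2 q3 q4 s0 s1 s2 s3 s4 = 0.
  by move=> oq os; rewrite /alt !fg0 // subrr.
have oddN q0 q1 q2 q3 q4 : odd_bits q0 q1 q2 q3 q4 ->
  [/\ ~~ odd_bits (~~ q0) q1 q2 q3 q4, ~~ odd_bits q0 (~~ q1) q2 q3 q4,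
      ~~ odd_bits q0 q1 (~~ q2) q3 q4, ~~ odd_bits q0 q1 q2 (~~ q3) q4
    & ~~ odd_bits q0 q1 q2 q3 (~~ q4)].
  by rewrite /odd_bits !(addNb, addbN) negbK => ->.
have [? ? ? ? ?] := oddN _ _ _ _ _ op; have [? ? ? ? ?] := oddN _ _ _ _ _ ot.
by rewrite !alt0 // !mulr0 !if_same !addr0.
Qed.
End FierzBits.

Section BasisForm.
Variable A : comNzRingType.
Implicit Types (phi psi : spinor A) (S T X : {set 'I_5}) (i j : 'I_5).

Definition toggle i S : {set 'I_5} := if i \in S then S :\ i else i |: S.

Lemma sgn_at_prod i S : sgn_at A i S = \prod_(j < 5 | (j < i)%N) (-1) ^+ (j \in S).
Proof.
rewrite /sgn_at -prodr_const big_mkcond [RHS]big_mkcond /=; apply: eq_bigr => j _.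
by rewrite !inE andbC; case: (j < i)%N; case: (j \in S).
Qed.

Lemma sgn_at_toggle i S : sgn_at A i (toggle i S) = sgn_at A i S.
Proof.
rewrite !sgn_at_prod; apply: eq_bigr => j ji; congr (_ ^+ _); congr nat_of_bool.
have jNi : j != i by rewrite -val_eqE /= ltn_eqF.
by rewrite /toggle; case: ifP => _; rewrite !inE (negPf jNi).
Qed.

Lemma wedge_basis i S : wedge i (spbasis A S) =
  (if i \in S then 0 else sgn_at A i S) *: spbasis A (toggle i S).
Proof.
apply: spinorP => T; rewrite spcoord_mk spcoordZ !spcoord_basis.
case iS: (i \in S).
  rewrite mul0r; case: ifP => // iT; case: eqP => [E|]; last by rewrite mulr0.
  by rewrite E !inE eqxx in iS.
rewrite -(sgn_at_toggle i S) /toggle iS; case: ifP => iT.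
  case: eqP => [E|nE]; first by rewrite E finset.setD1K // eqxx.
  by case: eqP => [E|]; rewrite ?mulr0 //; case: nE; rewrite -E finset.setU1K ?iS.
case: eqP => [E|]; last by rewrite mulr0.
by rewrite -E !inE eqxx in iT.
Qed.

Lemma contract_basis i S : contract i (spbasis A S) =
  (if i \in S then sgn_at A i S else 0) *: spbasis A (toggle i S).
Proof.
apply: spinorP => T; rewrite spcoord_mk spcoordZ !spcoord_basis.
case iS: (i \in S); last first.
  rewrite mul0r; case: ifP => // iT; case: eqP => [E|]; last by rewrite mulr0.
  by rewrite E !inE eqxx in iS.
rewrite -(sgn_at_toggle i S) /toggle iS; case: ifP => iT.
  case: eqP => [E|]; last by rewrite mulr0.
  by rewrite -E !inE eqxx in iT.
case: eqP => [E|nE]; first by rewrite E finset.setU1K ?iT // eqxx.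
by case: eqP => [E|]; rewrite ?mulr0 //; case: nE; rewrite -E finset.setD1K.
Qed.

Lemma clifford_section_basis phi psi S X :
  pairing psi (clifford (spinor_section (spbasis A S) phi) (spbasis A X)) =
  \sum_(i < 5) if (i \in S) (+) (i \in X) then
    (-1) ^+ (\big[addb/false]_(j < 5 | (j < i)%N) ((j \in S) (+) (j \in X))) *
    (spcoord phi (toggle i S) * spcoord psi (toggle i X)) else 0.
Proof.
rewrite /clifford (big_morph _ (pairingDr psi) (pairing0r psi)); apply: eq_bigr => i _.
rewrite /spinor_section row_mxEl row_mxEr !mxE pairingDr !pairingZr.
rewrite !wedge_basis !contract_basis !pairingZr !pairing_basis.
rewrite (big_morph (fun b : bool => (-1) ^+ b : A) (signr_addb A)
  (expr0 _ : (-1) ^+ false = 1)).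
rewrite (eq_bigr (fun j => (-1) ^+ (j \in S) * (-1) ^+ (j \in X))).
  by rewrite big_split -!sgn_at_prod; do 2! case: ifP => _ /=; ring.
by move=> j _; rewrite signr_addb.
Qed.

Definition bitset p0 p1 p2 p3 p4 : {set 'I_5} :=
  [set i : 'I_5 | nth false [:: p0; p1; p2; p3; p4] i].

Lemma bitsetP S : exists p0 p1 p2 p3 p4, S = bitset p0 p1 p2 p3 p4.
Proof.
exists (o5 0 \in S), (o5 1 \in S), (o5 2 \in S), (o5 3 \in S), (o5 4 \in S).
apply/setP => -[[|[|[|[|[|//]]]]] ?]; rewrite inE /=;
  apply: (congr1 (fun j : 'I_5 => j \in S)); exact/val_inj.
Qed.

Lemma toggle_bitset i p0 p1 p2 p3 p4 :
  toggle i (bitset p0 p1 p2 p3 p4) = match val i with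
    | 0 => bitset (~~ p0) p1 p2 p3 p4 | 1 => bitset p0 (~~ p1) p2 p3 p4
    | 2 => bitset p0 p1 (~~ p2) p3 p4 | 3 => bitset p0 p1 p2 (~~ p3) p4
    | _ => bitset p0 p1 p2 p3 (~~ p4) end%N.
Proof.
case: i => -[|[|[|[|[|//]]]]] ?; apply/setP => -[[|[|[|[|[|//]]]]] ?];
  rewrite /toggle inE /=; case: ifP; rewrite !inE -val_eqE //= => ->; by [].
Qed.

Lemma odd_bitset p0 p1 p2 p3 p4 : odd #|bitset p0 p1 p2 p3 p4| = odd_bits p0 p1 p2 p3 p4.
Proof.
rewrite -sum1_card big_mkcond /= !big_ord_recl big_ord0 /= !inE /= addn0 /odd_bits.
by case: p0 p1 p2 p3 p4 => [] [] [] [] [].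
Qed.

Definition spbits phi p0 p1 p2 p3 p4 := spcoord phi (bitset p0 p1 p2 p3 p4).

Lemma clifford_section_bits phi psi p0 p1 p2 p3 p4 t0 t1 t2 t3 t4 :
  pairing psi (clifford (spinor_section (spbasis A (bitset p0 p1 p2 p3 p4)) phi)
    (spbasis A (bitset t0 t1 t2 t3 t4))) =
  clifford_form (spbits phi) (spbits psi) p0 p1 p2 p3 p4 t0 t1 t2 t3 t4.
Proof.
rewrite clifford_section_basis.
under eq_bigr do rewrite big_mkcond /= !toggle_bitset.
rewrite !big_ord_recl !big_ord0 /= !inE /=.
rewrite !(addbF, addFb, addr0, addbA) expr0 mul1r /clifford_form -!addrA.
by rewrite !addbA.
Qed.

(** On even basis spinors the hypothesis is the vanishing of [clifford_form]. The conclusion is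
    proportionality in the form used by [summand1P]. *)
Lemma fierz (inj4 : forall a : A, 4 * a = 0 -> a = 0) phi psi :
  odd_spinor phi -> odd_spinor psi ->
  (forall s x, even_spinor s -> even_spinor x ->
     pairing psi (clifford (spinor_section s phi) x) = 0) ->
  phi^T *m psi = psi^T *m phi.
Proof.
move=> ophi opsi H.
suff E S T : spcoord phi S * spcoord psi T = spcoord psi S * spcoord phi T.
  apply/matrixP => k l; have := E (enum_val k) (enum_val l).
  by rewrite !mxE !big_ord1 !mxE /spcoord !enum_valK.
have [oS|eS] := boolP (odd #|S|); last by rewrite (ophi S) ?(opsi S) ?mul0r.
have [oT|eT] := boolP (odd #|T|); last by rewrite (ophi T) ?(opsi T) ?mulr0.
have [p0 [p1 [p2 [p3 [p4 ES]]]]] := bitsetP S; rewrite {S}ES odd_bitset in oS *.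
have [t0 [t1 [t2 [t3 [t4 ET]]]]] := bitsetP T; rewrite {T}ET odd_bitset in oT *.
rewrite [RHS]mulrC; apply: (@fierz_bits A (spbits phi) (spbits psi)) => // *.
by rewrite -clifford_section_bits H //; apply: even_basis; rewrite odd_bitset.
Qed.
End BasisForm.

(** * Isotropic subspaces and their spinor lines *)

Section MapSpinor.
Variables (A B : comNzRingType) (f : {rmorphism A -> B}).
Implicit Types (x phi s : spinor A).

Lemma spcoord_map x S : spcoord (map_mx f x : spinor B) S = f (spcoord x S).
Proof. by rewrite /spcoord mxE. Qed.

Lemma map_clifford v x :
  map_mx f (clifford v x) = clifford (map_mx f v) (map_mx f x : spinor B) :> spinor B.
Proof.
apply: spinorP => S; rewrite spcoord_map !spcoord_clifford rmorph_sum.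
apply: eq_bigr => i _; rewrite !spcoord_map !mxE /sgn_at.
by case: ifP => _; rewrite !rmorphM rmorph_sign.
Qed.

Lemma map_pairing phi x :
  f (pairing phi x) = pairing (map_mx f phi : spinor B) (map_mx f x : spinor B).
Proof. by rewrite /pairing map_trmx -map_mxM [RHS]mxE. Qed.

Lemma map_spbasis S : map_mx f (spbasis A S) = spbasis B S :> spinor B.
Proof. by apply: spinorP => T; rewrite spcoord_map !spcoord_basis rmorph_nat. Qed.

Lemma map_section s phi : map_mx f (spinor_section s phi) =
  spinor_section (map_mx f s : spinor B) (map_mx f phi : spinor B).
Proof.
rewrite /spinor_section map_row_mx; congr row_mx; apply/rowP => i;
  rewrite !mxE map_pairing; congr pairing; rewrite -!(clifford_e, clifford_f);
  by rewrite map_clifford map_delta_mx.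
Qed.
End MapSpinor.

Section LineClosure.
Variables (C : numFieldType) (A : comAlgType C).

(** Proportionality to row k of e gives e_kk x_j = x_k e_kj; summing over k with tr e = 1 yields x =
    x e. *)
Lemma line_absorb n (L : set 'rV[A]_n) x : is_summand 1 L ->
  (forall y, L y -> y^T *m x = x^T *m y) -> L x.
Proof.
move=> /summand1P[e [ee tre LE _]] xL; rewrite LE; exists x; apply/rowP => j.
rewrite -[LHS]mul1r -tre mulr_suml mxE; apply: eq_bigr => k _.
have /xL/matrixP/(_ k j) : L (row k e) by rewrite LE; exists (delta_mx 0 k); rewrite -rowE.
by rewrite !mxE !big_ord1 !mxE.
Qed.

Lemma rowim_sum n (e : 'M[A]_n) (I : finType) (c : I -> A) (u : I -> 'rV[A]_n) :
  (forall i, rowim e (u i)) -> rowim e (\sum_i c i *: u i).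
Proof.
move=> /boolp.choice[y yu].
exists (\sum_i c i *: y i); rewrite mulmx_suml; apply: eq_bigr => i _.
by rewrite -scalemxAl -yu.
Qed.

Section OG.
Variable U : set 'rV[A]_(5 + 5).
Hypothesis OGU : OGminus U.
Let L := spinor_line U.

Lemma section_OGminus phi s : L phi -> even_spinor s -> U (spinor_section s phi).
Proof.
case: OGU => sumU qU sumL [_ phiU] es; apply: lagrangian => // u Uu.
by rewrite spinor_sectionP phiU.
Qed.

Lemma spinor_line_pure : pure_spinors L.
Proof.
move=> phi psi s x Lphi Lpsi es ex.
by case: Lpsi => _; apply=> //; apply: section_OGminus.
Qed.

Lemma annihilator_spinor_line : annihilator L = U.
Proof.
case: (OGU) => -[e [ee UE rke]] qU sumL; apply/seteqP; split.
  apply: annihilator_reconstruct => // [phi []//|I c u|phi s].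
    by rewrite UE; apply: rowim_sum.
  exact: section_OGminus.
by move=> u Uu phi x [_]; apply.
Qed.
End OG.

Section Line.
Variable L : set (spinor A).
Hypotheses (sumL : is_summand 1 L) (oddL : L `<=` @odd_spinor A) (pureL : pure_spinors L).

(** By purity the annihilator contains the values of all sections at psi in L. A form phi that
    vanishes on annihilator(L) . Delta_+ therefore meets the hypothesis of [fierz] with every psi in
    L, and [line_absorb] applies. *)
Lemma spinor_line_annihilator : spinor_line (annihilator L) = L.
Proof.
apply/seteqP; split=> [phi [ophi phiL]|phi Lphi]; last first.
  by split=> [|u x]; [exact: oddL|apply].
apply: line_absorb => // psi Lpsi; apply: (fierz (@mulIn_alg _ _ 3)) => // [|s x es ex].
  exact: oddL.
by apply: phiL => // chi y Lchi ey; apply: pureL.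
Qed.

Lemma OGminus_annihilator : OGminus (annihilator L).
Proof.
split; first exact: annihilator_summand.
  by move=> u; apply: annihilator_isotropic.
by rewrite spinor_line_annihilator.
Qed.
End Line.
End LineClosure.

(** The alternative [c i = 0] serves expansions of even spinors over all basis spinors, where only
    the even ones are known to give elements of M. *)
Lemma base_change_sum (A B : comNzRingType) (f : {rmorphism A -> B}) n (M : set 'rV[A]_n)
    (I : finType) (c : I -> B) (u : I -> 'rV[A]_n) :
  (forall i, c i = 0 \/ M (u i)) -> M 0 -> base_change f M (\sum_i c i *: map_mx f (u i)).
Proof.
move=> Mu M0; exists #|I|, (fun i => c (enum_val i)).
exists (fun i => if `[< M (u (enum_val i)) >] then u (enum_val i) else 0).
split=> [i|]; first by case: asboolP.
rewrite (reindex _ (onW_bij _ (@enum_val_bij I))); apply: eq_bigr => i _.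
case: asboolP => //; case: (Mu (enum_val i)) => // -> _.
by rewrite !scale0r.
Qed.

Section BaseChange.
Variables (C : numFieldType) (A B : comAlgType C) (f : {rmorphism A -> B}).
Variable U : set 'rV[A]_(5 + 5).
Hypothesis OGU : OGminus U.

(** The line is defined by equations, so only one inclusion is formal. For the other, a form over B
    that satisfies the equations is proportional to the images of the elements of [spinor_line U],
    by [fierz]. *)
Lemma spinor_line_base_change :
  spinor_line (base_change f U) = base_change f (spinor_line U).
Proof.
have [_ _ sumL] := OGU.
have [e [ee tre LE _]] := (summand1P _).1 sumL.
have sumB : is_summand 1 (base_change f (spinor_line U)).
  rewrite LE base_change_rowim //; apply: is_summand_trace.
    by rewrite -map_mxM ee.
  by rewrite trace_map_mx tre rmorph1.
have U0 : U 0 by have [[e' [_ -> _]] _ _] := OGU; exists 0; rewrite mul0mx.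
apply/seteqP; split=> [phi [ophi phiU]|_ [k [b [l [Ll ->]]]]].
  apply: line_absorb sumB _ => _ [k [b [l [Ll ->]]]].
  rewrite linear_sum mulmx_suml mulmx_sumr; apply: eq_bigr => i _ /=.
  rewrite linearZ -scalemxAl -scalemxAr; congr (_ *: _).
  have [oli _] := Ll i; apply: (fierz (@mulIn_alg _ _ 3)) => // [S eS|s x es ex].
    by rewrite spcoord_map oli ?rmorph0.
  apply: phiU => //; rewrite [s]spinor_sum_basis section_suml.
  under eq_bigr do rewrite -(map_spbasis f) -map_section.
  apply: base_change_sum => // S.
  have [oS|eS] := boolP (odd #|S|); first by left; apply: es.
  by right; apply: section_OGminus => //; apply: even_basis.
split=> [S eS|_ x [m [c [u [Uu ->]]]] ex].
  rewrite /spcoord summxE big1 // => i _; rewrite mxE -/(spcoord _ _) spcoord_map.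
  by have [oli _] := Ll i; rewrite oli // rmorph0 mulr0.
rewrite pairing_suml big1 // => i _; rewrite clifford_suml pairing_sumr big1 ?mulr0 // => j _.
rewrite [x]spinor_sum_basis clifford_sumr pairing_sumr big1 ?mulr0 // => S _.
have [oS|eS] := boolP (odd #|S|); first by rewrite ex // mul0r.
rewrite -(map_spbasis f) -map_clifford -map_pairing.
have [_ ->] := Ll i; rewrite ?rmorph0 ?mulr0 //; exact: even_basis.
Qed.
End BaseChange.

(** * Zero loci and parametrized quadrics *)

(* [T] is a basis of the linear forms on Delta_- that vanish on V . s. The point of
   OG attached to [phi] is in the zero locus of [s] when [phi] is such a form; the
   last clause says that [G] gives the equation of pure spinors among them. *)
Definition quadric_parametrization (C : numFieldType) (s : spinor C) (G : 'M[C]_7)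
    (T : 'M[C]_(7, N)) (T' : 'M[C]_(N, 7)) :=
  T *m T' = 1%:M /\ forall A : comAlgType C,
  [/\ forall phi : spinor A, odd_spinor phi -> spinor_section s%:A[A] phi = 0 ->
        phi *m T'%:A[A] *m T%:A[A] = phi,
      forall y : 'rV[A]_7, odd_spinor (y *m T%:A[A] : spinor A) /\
        spinor_section s%:A[A] (y *m T%:A[A]) = 0
    & forall y : 'rV[A]_7, qform G%:A[A] y = 0 <->
        forall t x : spinor A, even_spinor t -> even_spinor x ->
        pairing (y *m T%:A[A] : spinor A)
          (clifford (spinor_section t (y *m T%:A[A])) x) = 0].

Section PolarPure.
Variables (A : comNzRingType) (t x : spinor A).
Implicit Types phi psi : spinor A.

(** Bilinearity, written so that phi and psi enter only through phi^T psi, which is symmetric on a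
    line. *)
Lemma pairing_sectionE phi psi : pairing psi (clifford (spinor_section t phi) x) =
  \sum_k \sum_l (phi^T *m psi) k l *
    pairing (delta_mx 0 l : spinor A) (clifford (spinor_section t (delta_mx 0 k)) x).
Proof.
have secE : spinor_section t phi = \sum_k phi 0 k *: spinor_section t (delta_mx 0 k).
  apply: polarV_inj => v; rewrite {1}(row_sum_delta phi) !spinor_sectionP pairing_suml.
  rewrite (big_morph (fun u => polarV u v) (fun u w => polarVDl u w v) (polarV0l v)).
  by apply: eq_bigr => k _; rewrite polarVZl spinor_sectionP.
rewrite secE clifford_suml pairing_sumr; apply: eq_bigr => k _.
rewrite {1}(row_sum_delta psi) pairing_suml mulr_sumr; apply: eq_bigr => l _.
by rewrite !mxE big_ord1 !mxE mulrA.
Qed.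

Lemma pairing_section_sym phi psi : phi^T *m psi = psi^T *m phi ->
  pairing psi (clifford (spinor_section t phi) x) =
  pairing phi (clifford (spinor_section t psi) x).
Proof. by move=> E; rewrite !pairing_sectionE E. Qed.

Lemma pairing_section_add phi psi :
  pairing (phi + psi) (clifford (spinor_section t (phi + psi)) x) =
  pairing phi (clifford (spinor_section t phi) x) +
  (pairing psi (clifford (spinor_section t phi) x) +
   pairing phi (clifford (spinor_section t psi) x)) +
  pairing psi (clifford (spinor_section t psi) x).
Proof.
have -> : spinor_section t (phi + psi) = spinor_section t phi + spinor_section t psi.
  by have := section_linr 1 t phi psi; rewrite !scale1r.
by rewrite cliffordDl pairingDl !pairingDr; ring.
Qed.
End PolarPure.

Lemma preimage_rowim (A : comNzRingType) m n (e : 'M[A]_n) (T : 'M[A]_(m, n)) T' :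
  e *m e = e -> T *m T' = 1%:M -> e *m T' *m T = e ->
  [set y | rowim e (y *m T)] = rowim (T *m e *m T').
Proof.
move=> ee TT eT; apply/seteqP; split=> [y [z yz]|_ [z ->]] /=.
  exists y; rewrite !mulmxA yz -[z *m e *m e]mulmxA ee -yz.
  by rewrite -mulmxA TT mulmx1.
by exists (z *m T); rewrite -!mulmxA (mulmxA e) eT.
Qed.

Lemma conj_idem (A : comNzRingType) m n (e : 'M[A]_n) (T : 'M[A]_(m, n)) T' :
  e *m e = e -> e *m T' *m T = e ->
  (T *m e *m T') *m (T *m e *m T') = T *m e *m T'.
Proof.
move=> ee eT; rewrite !mulmxA -[T *m e *m T']mulmxA -[T *m (e *m T') *m T]mulmxA eT.
by rewrite -[T *m e *m e]mulmxA ee mulmxA.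
Qed.

Section Isomorphism.
Variables (C : numFieldType) (s : spinor C) (G : 'M[C]_7).
Variables (T : 'M[C]_(7, N)) (T' : 'M[C]_(N, 7)).
Hypothesis paramT : quadric_parametrization s G T T'.

(** The isomorphism: the spinor line of U in the coordinates given by the rows of T. *)
Let F (A : comAlgType C) (U : set 'rV[A]_(5 + 5)) : set 'rV[A]_7 :=
  [set y | spinor_line U (y *m T%:A[A])].

Let TT (A : comAlgType C) : T%:A[A] *m T'%:A[A] = 1%:M.
Proof. by rewrite -map_mxM paramT.1 map_mx1. Qed.

Lemma zero_locus_line (A : comAlgType C) (U : set 'rV[A]_(5 + 5)) : zero_locus s U ->
  exists e : 'M[A]_N, [/\ e *m e = e, \tr e = 1, spinor_line U = rowim e,
    e *m T'%:A[A] *m T%:A[A] = e & F U = rowim (T%:A[A] *m e *m T'%:A[A])].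
Proof.
move=> [[_ _ /summand1P[e [ee tre LE _]]] Us].
have eT : e *m T'%:A[A] *m T%:A[A] = e.
  apply/row_matrixP => k; rewrite !row_mul; have [-> //] := paramT.2 A.
    by suff [] : spinor_line U (row k e) by []; rewrite LE rowE; exists (delta_mx 0 k).
  by apply: Us; rewrite LE rowE; exists (delta_mx 0 k).
exists e; split=> //.
by rewrite /F LE (preimage_rowim ee (TT A) eT).
Qed.

Lemma zero_locus_quadric (A : comAlgType C) (U : set 'rV[A]_(5 + 5)) :
  zero_locus s U -> quadric G (F U).
Proof.
move=> XU; have [e [ee tre LE eT FE]] := zero_locus_line XU; split.
  rewrite FE; apply: is_summand_trace.
    exact: conj_idem.
  by rewrite mxtrace_mulC mulmxA mxtrace_mulC mulmxA eT tre.
move=> y Fy; have [_ _ qE] := paramT.2 A; apply/qE => t x et ex.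
by apply: (spinor_line_pure XU.1).
Qed.

Lemma zero_locus_isomorphic : isomorphic (zero_locus s) (quadric G).
Proof.
exists F; split=> [A|A B f U XU]; last first.
  have [e [ee tre LE eT FE]] := zero_locus_line XU.
  have inB m n (M : 'M[C]_(m, n)) : map_mx f M%:A[A] = M%:A[B].
    by rewrite -map_mx_comp; apply: eq_map_mx => c; exact: rmorph_alg.
  rewrite FE base_change_rowim; last first.
    exact: conj_idem.
  rewrite /F (spinor_line_base_change f XU.1) LE base_change_rowim //.
  rewrite (preimage_rowim (T' := T'%:A[B])) //.
  - by rewrite !map_mxM !inB.
  - by rewrite -map_mxM ee.
  - exact: TT.
  - by rewrite -!inB -!map_mxM eT.
split=> [U XU||L QL]; first exact: zero_locus_quadric.
  move=> U1 U2 /set_mem X1 /set_mem X2 F12.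
  rewrite -(annihilator_spinor_line X1.1) -(annihilator_spinor_line X2.1); congr annihilator.
  have sub (V1 V2 : set 'rV[A]_(5 + 5)) :
      zero_locus s V1 -> F V1 = F V2 -> spinor_line V1 `<=` spinor_line V2.
    move=> X E phi phiV1; have [phiE _ _] := paramT.2 A.
    have {}phiE : phi *m T'%:A[A] *m T%:A[A] = phi.
      by apply: phiE; [case: phiV1|apply: X.2].
    have : F V1 (phi *m T'%:A[A]) by rewrite /F /= phiE.
    by rewrite E /F /= phiE.
  by apply/seteqP; split; apply: sub.
have [sumL qL] := QL; have [e [ee tre LE prL]] := (summand1P L).1 sumL.
have [phiE secT qE] := paramT.2 A.
(* M is the line L T of forms; its annihilator is the preimage of L. *)
pose d := T'%:A[A] *m e *m T%:A[A]; pose M := rowim d.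
have dd : d *m d = d.
  by rewrite /d -!mulmxA (mulmxA T%:A[A]) TT mul1mx (mulmxA e e) ee.
have ML phi : M phi -> exists2 y, L y & phi = y *m T%:A[A].
  by move=> [z ->]; exists (z *m T'%:A[A] *m e); rewrite ?mulmxA // LE; exists (z *m T'%:A[A]).
have sumM : is_summand 1 M.
  apply: is_summand_trace => //.
  by rewrite /d mxtrace_mulC mulmxA TT mul1mx tre.
have oddM : M `<=` @odd_spinor A by move=> _ /ML[y _ ->]; have [] := secT y.
have pureM : pure_spinors M.
  (* Purity is bilinear while the quadric gives only the diagonal: the equations at y, z and y + z
     leave two mixed terms, equal because y and z are proportional, so 2 is cancelled. *)
  move=> _ _ t x /ML[y Ly ->] /ML[z Lz ->] et ex; apply: (@mulIn_alg _ _ 1).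
  have LD : L (y + z).
    by move: Ly Lz; rewrite LE => -[u ->] [v ->]; exists (u + v); rewrite mulmxDl.
  have := (qE _).1 (qL _ LD) _ _ et ex; rewrite mulmxDl pairing_section_add.
  rewrite ((qE _).1 (qL _ Ly)) // ((qE _).1 (qL _ Lz)) // add0r addr0.
  rewrite [X in _ + X]pairing_section_sym; first by rewrite mulr_natl mulr2n.
  by rewrite !trmx_mul !mulmxA -(mulmxA _ z^T) -(mulmxA _ y^T) prL.
have UM := spinor_line_annihilator sumM oddM pureM.
exists (annihilator M); first split; first exact: OGminus_annihilator.
  by rewrite UM => _ /ML[y _ ->]; have [] := secT y.
rewrite /F UM /M (preimage_rowim (T' := T'%:A[A])) //.
  by rewrite /d !mulmxA TT mul1mx -mulmxA TT mulmx1.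
  exact: TT.
by rewrite /d -!mulmxA (mulmxA T%:A[A]) TT mul1mx.
Qed.
End Isomorphism.

(** * Transvections *)

Lemma parametrization_congr (C : numFieldType) (s : spinor C) G T T' (P : 'M[C]_7) :
  P \in unitmx -> quadric_parametrization s G T T' ->
  quadric_parametrization s (P *m G *m P^T) (P *m T) (T' *m invmx P).
Proof.
move=> uP [TT par]; split; first by rewrite !mulmxA -(mulmxA P) TT mulmx1 mulmxV.
move=> A; have [phiE secT qE] := par A; split=> [phi ophi sphi|y|y].
- by rewrite -mulmxA -map_mxM !mulmxA mulmxKV // map_mxM mulmxA phiE.
- by rewrite map_mxM mulmxA; apply: secT.
- have -> : qform (P *m G *m P^T)%:A[A] y = qform G%:A[A] (y *m P%:A[A]).
    by rewrite /qform !map_mxM trmx_mul map_trmx !mulmxA.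
  by rewrite map_mxM mulmxA; apply: qE.
Qed.

Section Transvection.
Variables (A : comNzRingType).
Implicit Types (x s phi psi : spinor A) (u v w z : 'rV[A]_(5 + 5)).

(* The element [1 + u w] of the Clifford algebra, in the spin group when [u] and
   [w] span an isotropic plane, and the isometry that it induces. *)
Definition transv u w x : spinor A := x + clifford u (clifford w x).
Definition transvV u w v := v + polarV w v *: u - polarV u v *: w.

Definition isotropic_pair u w := [/\ quadV u = 0, quadV w = 0 & polarV u w = 0].

Lemma quadVN u : quadV (- u) = quadV u.
Proof. by rewrite /quadV; apply: eq_bigr => i _; rewrite !mxE mulrNN. Qed.

Lemma polarVNl v w : polarV (- v) w = - polarV v w.
Proof. by rewrite -scaleN1r polarVZl mulN1r. Qed.

Lemma isotropic_pairN u w : isotropic_pair u w -> isotropic_pair (- u) w.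
Proof. by case=> qu qw uw; split=> //; rewrite ?quadVN // polarVNl uw oppr0. Qed.

Lemma polarV_self w : polarV w w = 2 * quadV w.
Proof. by rewrite polarVE /quadV mulr_sumr; apply: eq_bigr => i _; ring. Qed.

Lemma cliffordNl u x : clifford (- u) x = - clifford u x.
Proof. by rewrite -scaleN1r cliffordZl scaleN1r. Qed.

Section Pair.
Variables (u w : 'rV[A]_(5 + 5)).
Hypothesis uw : isotropic_pair u w.

Let clifford_uu x : clifford u (clifford u x) = 0.
Proof. by case: uw => qu _ _; rewrite clifford_sq qu scale0r. Qed.

Let clifford_ww x : clifford w (clifford w x) = 0.
Proof. by case: uw => _ qw _; rewrite clifford_sq qw scale0r. Qed.

Let clifford_wu x : clifford w (clifford u x) = - clifford u (clifford w x).
Proof.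
by case: uw => _ _ p; apply/eqP; rewrite -addr_eq0 addrC clifford_polar p scale0r.
Qed.

Lemma transvK x : transv (- u) w (transv u w x) = x.
Proof.
rewrite /transv !cliffordDr !cliffordNl clifford_wu !cliffordNr clifford_uu.
by rewrite !oppr0 addr0 addrK.
Qed.

Lemma clifford_transv v x :
  clifford (transvV u w v) (transv u w x) = transv u w (clifford v x).
Proof.
have vw y : clifford w (clifford v y) = polarV w v *: y - clifford v (clifford w y).
  by rewrite -(clifford_polar w v) addrK.
have vu y : clifford u (clifford v y) = polarV u v *: y - clifford v (clifford u y).
  by rewrite -(clifford_polar u v) addrK.
rewrite /transv /transvV !cliffordDl cliffordNl !cliffordZl !cliffordDr.
rewrite clifford_uu clifford_wu clifford_ww clifford0r oppr0 !addr0 vw cliffordDr.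
rewrite cliffordNr cliffordZr vu.
rewrite opprB addrA addrAC addrA; apply/rowP => k; rewrite !mxE; ring.
Qed.

Lemma transvVK v : transvV u w (transvV (- u) w v) = v.
Proof.
case: uw => qu qw p; rewrite /transvV !(polarVC w) !(polarVC u) !polarVNl.
rewrite !(polarVDl, polarVNl, polarVZl) !polarV_self qu qw (polarVC w u) p.
by rewrite -!(polarVC v); apply/rowP => k; rewrite !mxE; ring.
Qed.

Lemma polarV_transvV z v : polarV z (transvV u w v) = polarV (transvV (- u) w z) v.
Proof.
rewrite /transvV (polarVC z) !(polarVDl, polarVNl, polarVZl).
by rewrite (polarVC v z) (polarVC u z) (polarVC w z); ring.
Qed.
End Pair.

Lemma transv_lin u w (I : finType) (c : I -> A) (x : I -> spinor A) :
  transv u w (\sum_i c i *: x i) = \sum_i c i *: transv u w (x i).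
Proof.
rewrite /transv !clifford_sumr -big_split; apply: eq_bigr => i _ /=.
by rewrite scalerDr.
Qed.

Lemma transv_even u w x : even_spinor x -> even_spinor (transv u w x).
Proof.
move=> ex S oS; rewrite /spcoord mxE -!/(spcoord _ _) ex // add0r.
by apply: (clifford_odd u) oS; apply: clifford_even.
Qed.

Definition transv_mx u w : 'M[A]_N := \matrix_k transv u w (delta_mx 0 k).

Lemma mul_transv_mx u w x : x *m transv_mx u w = transv u w x.
Proof.
rewrite mulmx_sum_row [in RHS](row_sum_delta x) transv_lin.
by apply: eq_bigr => k _; rewrite rowK.
Qed.

Lemma transv_mxK u w : isotropic_pair u w -> transv_mx u w *m transv_mx (- u) w = 1%:M.
Proof.
move=> uw; apply/row_matrixP => k.
by rewrite [LHS]rowE mulmxA !mul_transv_mx transvK // rowE mulmx1.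
Qed.

Lemma pairing_transv u w phi x :
  pairing (phi *m (transv_mx u w)^T : spinor A) x = pairing phi (transv u w x).
Proof. by rewrite /pairing -mulmxA -trmx_mul mul_transv_mx. Qed.

Lemma odd_transv u w phi : odd_spinor phi -> odd_spinor (phi *m (transv_mx u w)^T : spinor A).
Proof.
move=> ophi S eS; rewrite -pairing_basis pairing_transv pairingE big1 // => T _.
have [oT|eT] := boolP (odd #|T|); last by rewrite ophi // mul0r.
by rewrite (transv_even _ _ (even_basis A eS)) // mulr0.
Qed.

Lemma section_transv u w s phi : isotropic_pair u w ->
  spinor_section s (phi *m (transv_mx u w)^T) =
  transvV (- u) w (spinor_section (transv u w s) phi).
Proof.
move=> uw; apply: polarV_inj => v; rewrite -polarV_transvV // !spinor_sectionP.
by rewrite pairing_transv clifford_transv.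
Qed.

Lemma transvV0 u w : transvV u w 0 = 0.
Proof. by rewrite /transvV !(polarVC _ 0) !polarV0l !scale0r addr0 subr0. Qed.
End Transvection.

Lemma map_polarV (A B : comNzRingType) (f : {rmorphism A -> B}) (u v : 'rV[A]_(5 + 5)) :
  polarV (map_mx f u) (map_mx f v) = f (polarV u v).
Proof.
by rewrite !polarVE rmorph_sum; apply: eq_bigr => i _; rewrite !mxE rmorphD !rmorphM.
Qed.

Lemma map_quadV (A B : comNzRingType) (f : {rmorphism A -> B}) (u : 'rV[A]_(5 + 5)) :
  quadV (map_mx f u) = f (quadV u).
Proof. by rewrite /quadV rmorph_sum; apply: eq_bigr => i _; rewrite !mxE rmorphM. Qed.

Lemma map_transv_mx (A B : comNzRingType) (f : {rmorphism A -> B}) (u w : 'rV[A]_(5 + 5)) :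
  map_mx f (transv_mx u w) = transv_mx (map_mx f u) (map_mx f w).
Proof.
apply/row_matrixP => k; rewrite -map_row !rowK /transv map_mxD !map_clifford.
by rewrite map_delta_mx.
Qed.

(** The transvection acts on forms by its transpose and permutes the even spinors that test purity,
    so the same G works. *)
Lemma parametrization_transv (C : numFieldType) (s : spinor C) (u w : 'rV[C]_(5 + 5)) G T T' :
  isotropic_pair u w -> quadric_parametrization (transv u w s) G T T' ->
  quadric_parametrization s G (T *m (transv_mx u w)^T) ((transv_mx (- u) w)^T *m T').
Proof.
move=> uw [TT par]; split.
  have := transv_mxK (isotropic_pairN uw); rewrite opprK => uwK.
  by rewrite !mulmxA -(mulmxA T) -trmx_mul uwK trmx1 mulmx1.
move=> A; have [phiE secT qE] := par A.
have uwA : isotropic_pair u%:A[A] w%:A[A].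
  by case: uw => qu qw p; split; rewrite ?map_quadV ?map_polarV ?qu ?qw ?p rmorph0.
have sA : (transv u w s)%:A[A] = transv u%:A[A] w%:A[A] (s%:A[A] : spinor A) :> spinor A.
  by rewrite /transv map_mxD !map_clifford.
have NuA : (- u)%:A[A] = - u%:A[A] by rewrite map_mxN.
have TRE (y : 'rV[A]_7) : y *m (T *m (transv_mx u w)^T)%:A[A] =
    y *m T%:A[A] *m (transv_mx u%:A[A] w%:A[A])^T.
  by rewrite map_mxM mulmxA -map_trmx map_transv_mx.
split=> [phi ophi sphi|y|y].
- rewrite TRE map_mxM -map_trmx map_transv_mx NuA mulmxA phiE.
  + rewrite -mulmxA -trmx_mul transv_mxK // trmx1 mulmx1 //.
  + exact: odd_transv.
  + rewrite sA section_transv; last exact: isotropic_pairN.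
    by rewrite transvK // sphi transvV0.
- rewrite TRE; have [oy sy] := secT y; split; first exact: odd_transv.
  by rewrite section_transv // -sA sy transvV0.
- rewrite qE TRE.
  have E t x : pairing (y *m T%:A[A] *m (transv_mx u%:A[A] w%:A[A])^T : spinor A)
      (clifford (spinor_section t (y *m T%:A[A] *m (transv_mx u%:A[A] w%:A[A])^T)) x) =
    pairing (y *m T%:A[A] : spinor A) (clifford
      (spinor_section (transv u%:A[A] w%:A[A] t) (y *m T%:A[A])) (transv u%:A[A] w%:A[A] x)).
    by rewrite pairing_transv section_transv // -clifford_transv // transvVK.
  split=> H t x et ex; first by rewrite E H //; apply: transv_even.
  have K z : z = transv u%:A[A] w%:A[A] (transv (- u%:A[A]) w%:A[A] z) :> spinor A.
    by rewrite -{1}[u%:A[A]]opprK transvK //; apply: isotropic_pairN.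
  by rewrite (K t) (K x) -E H //; apply: transv_even.
Qed.

(** * The normal form of a general spinor *)

Lemma sum5E (V : nmodType) (F : 'I_5 -> V) :
  \sum_i F i = F (o5 0) + (F (o5 1) + (F (o5 2) + (F (o5 3) + F (o5 4)))).
Proof.
by rewrite !big_ord_recl big_ord0 addr0; do ![congr (_ + _)]; congr F; apply: val_inj.
Qed.

Lemma sum7E (V : nmodType) (F : 'I_7 -> V) :
  \sum_i F i = F (o7 0) + (F (o7 1) + (F (o7 2) + (F (o7 3) +
    (F (o7 4) + (F (o7 5) + F (o7 6)))))).
Proof.
by rewrite !big_ord_recl big_ord0 addr0; do ![congr (_ + _)]; congr F; apply: val_inj.
Qed.

Lemma bitset_eq p0 p1 p2 p3 p4 t0 t1 t2 t3 t4 :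
  (bitset p0 p1 p2 p3 p4 == bitset t0 t1 t2 t3 t4) =
  [&& p0 == t0, p1 == t1, p2 == t2, p3 == t3 & p4 == t4].
Proof.
apply/eqP/and5P=> [/setP E|[/eqP-> /eqP-> /eqP-> /eqP-> /eqP->] //].
by split; [move: (E (o5 0))|move: (E (o5 1))|move: (E (o5 2))|move: (E (o5 3))|
  move: (E (o5 4))]; rewrite !inE /= => ->.
Qed.

Lemma pairing_clifford_bits (A : comNzRingType) (phi : spinor A) v p0 p1 p2 p3 p4 :
  let f := spbits phi in
  pairing phi (clifford v (spbasis A (bitset p0 p1 p2 p3 p4))) =
  (if p0 then v 0 (rshift 5 (o5 0)) else v 0 (lshift 5 (o5 0))) * f (~~ p0) p1 p2 p3 p4 +
  (if p1 then v 0 (rshift 5 (o5 1)) else v 0 (lshift 5 (o5 1))) *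
    ((-1) ^+ p0 * f p0 (~~ p1) p2 p3 p4) +
  (if p2 then v 0 (rshift 5 (o5 2)) else v 0 (lshift 5 (o5 2))) *
    ((-1) ^+ p0 * (-1) ^+ p1 * f p0 p1 (~~ p2) p3 p4) +
  (if p3 then v 0 (rshift 5 (o5 3)) else v 0 (lshift 5 (o5 3))) *
    ((-1) ^+ p0 * (-1) ^+ p1 * (-1) ^+ p2 * f p0 p1 p2 (~~ p3) p4) +
  (if p4 then v 0 (rshift 5 (o5 4)) else v 0 (lshift 5 (o5 4))) *
    ((-1) ^+ p0 * (-1) ^+ p1 * (-1) ^+ p2 * (-1) ^+ p3 * f p0 p1 p2 p3 (~~ p4)).
Proof.
move=> f; rewrite /clifford (big_morph _ (pairingDr phi) (pairing0r phi)).
have E i : pairing phi (v 0 (lshift 5 i) *: wedge i (spbasis A (bitset p0 p1 p2 p3 p4)) +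
      v 0 (rshift 5 i) *: contract i (spbasis A (bitset p0 p1 p2 p3 p4))) =
    (if i \in bitset p0 p1 p2 p3 p4 then v 0 (rshift 5 i) else v 0 (lshift 5 i)) *
    (sgn_at A i (bitset p0 p1 p2 p3 p4) * spcoord phi (toggle i (bitset p0 p1 p2 p3 p4))).
  rewrite pairingDr !pairingZr wedge_basis contract_basis !pairingZr pairing_basis.
  by case: ifP => _; ring.
rewrite sum5E !E !toggle_bitset !sgn_at_prod !(big_mkcond (fun j => _ < _)%N) /=.
rewrite !big_ord_recl !big_ord0 /= !inE /= !mul1r !mulr1 -!addrA.
by rewrite !mulrA.
Qed.

(** * The quadric attached to a + c e_1 /\ e_2 /\ e_3 /\ e_4 *)

Section Cone.
Variables (A : comNzRingType) (a c : A) (y : 'rV[A]_7).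

(** Coordinates of a form that vanishes on V . s. Those on odd sets without 5 are killed by a or c;
    the relation a phi(e_5) + c phi(e_1 /\ ... /\ e_5) = 0 ties two of the others to the single
    parameter y_0. *)
Definition cone_bits (p0 p1 p2 p3 p4 : bool) : A :=
  if ~~ p4 then 0 else match p0, p1, p2, p3 with
  | false, false, false, false => - c * y 0 (o7 0)
  | true, true, true, true => a * y 0 (o7 0)
  | true, true, false, false => y 0 (o7 1)
  | true, false, true, false => y 0 (o7 2)
  | true, false, false, true => y 0 (o7 3)
  | false, true, true, false => y 0 (o7 4)
  | false, true, false, true => y 0 (o7 5)
  | false, false, true, true => y 0 (o7 6)
  | _, _, _, _ => 0
  end.

(** The product of the coordinates on {5} and {1,2,3,4,5} minus the Pfaffian of those on the
    {i,j,5}: the invariant quadratic form of a half-spin representation of Spin_8. *)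
Definition cone_form : A := y 0 (o7 2) * y 0 (o7 5) - y 0 (o7 1) * y 0 (o7 6) -
  y 0 (o7 3) * y 0 (o7 4) - a * c * y 0 (o7 0) * y 0 (o7 0).

Lemma clifford_form_cone p0 p1 p2 p3 p4 t0 t1 t2 t3 t4 : cone_form = 0 ->
  ~~ odd_bits p0 p1 p2 p3 p4 -> ~~ odd_bits t0 t1 t2 t3 t4 ->
  clifford_form cone_bits cone_bits p0 p1 p2 p3 p4 t0 t1 t2 t3 t4 = 0.
Proof.
move=> q0; have Nq0 : - cone_form = 0 by rewrite q0 oppr0.
(* Each polarized equation is identically 0, or [cone_form] up to sign. *)
case: p0; case: p1; case: p2; case: p3; case: p4 => // _;
  case: t0; case: t1; case: t2; case: t3; case: t4 => // _;
  rewrite /clifford_form /cone_bits /= ?expr0 ?expr1;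
  first [ring | rewrite -[RHS]q0 /cone_form; ring | rewrite -[RHS]Nq0 /cone_form; ring].
Qed.

Lemma clifford_form_cone_eq :
  clifford_form cone_bits cone_bits false true true true true true false false false true =
  cone_form.
Proof. by rewrite /clifford_form /cone_bits /cone_form /= ?expr0 ?expr1; ring. Qed.
End Cone.

Section AntidiagonalGram.
Variable C : fieldType.

(** Index i is paired with -i modulo 7: 0 with itself, and 1, ..., 6 in the three hyperbolic planes
    y_1 y_6, y_2 y_5, y_3 y_4 of [cone_form]. With x = -2ac this is the Gram matrix of twice
    [cone_form]. *)
Definition antidiag_gram (x : C) : 'M[C]_7 := \matrix_(i, j)
  if j == ((7 - i) %% 7)%N :> nat then nth 0 [:: x; -1; 1; -1; -1; 1; -1] i else 0.

Lemma antidiag_gram_tr x : (antidiag_gram x)^T = antidiag_gram x.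
Proof.
by apply/matrixP => -[[|[|[|[|[|[|[|//]]]]]]] ?] [[|[|[|[|[|[|[|//]]]]]]] ?]; rewrite !mxE.
Qed.

Lemma antidiag_gram_unit x : x != 0 -> antidiag_gram x \in unitmx.
Proof.
move=> x0; suff /mulmx1_unit[] : antidiag_gram x *m antidiag_gram x^-1 = 1%:M by [].
apply/matrixP => i j; pose r : 'I_7 := Ordinal (ltn_pmod (7 - i) (isT : 0 < 7)%N).
rewrite mxE (bigD1 r) //= big1 ?addr0 => [|k kr]; last first.
  by rewrite mxE; case: eqP => [E|]; rewrite ?mul0r //; case/eqP: kr; apply: val_inj.
rewrite !mxE eqxx /=; case: i j @r => [[|[|[|[|[|[|[|//]]]]]]] ?] [[|[|[|[|[|[|[|//]]]]]]] ?];
  by rewrite /= ?mulr0 ?mulrNN ?mulr1 ?divff.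
Qed.
End AntidiagonalGram.

Section BaseCase.
Variables (C : numFieldType) (a c : C).
Hypotheses (a0 : a != 0) (c0 : c != 0).

Local Notation d p0 p1 p2 p3 p4 := (spbasis C (bitset p0 p1 p2 p3 p4)).

(* a + c e_1 /\ e_2 /\ e_3 /\ e_4 *)
Definition base_spinor : spinor C :=
  a *: d false false false false false + c *: d true true true true false.

Definition cone_basis (k : nat) : spinor C := nth 0
  [:: - c *: d false false false false true + a *: d true true true true true;
      d true true false false true; d true false true false true;
      d true false false true true; d false true true false true;
      d false true false true true; d false false true true true] k.

Definition cone_mx : 'M[C]_(7, N) := \matrix_k cone_basis k.

Definition cone_dual (k : nat) : spinor C := nth 0
  [:: a^-1 *: d true true true true true;
      d true true false false true; d true false true false true;
      d true false false true true; d false true true false true;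
      d false true false true true; d false false true true true] k.

Definition cone_inv : 'M[C]_(N, 7) := (\matrix_k cone_dual k)^T.

Definition cone_gram : 'M[C]_7 := antidiag_gram (- (2 * a * c)).

Lemma cone_gram_unit : cone_gram \in unitmx.
Proof. by apply: antidiag_gram_unit; rewrite oppr_eq0 !mulf_neq0 // pnatr_eq0. Qed.

Lemma cone_mxK : cone_mx *m cone_inv = 1%:M.
Proof.
apply/matrixP => i j.
have -> : (cone_mx *m cone_inv) i j = pairing (cone_basis i) (cone_dual j).
  by rewrite /pairing !mxE; apply: eq_bigr => k _; rewrite !mxE.
case: i j => [[|[|[|[|[|[|[|//]]]]]]] ?] [[|[|[|[|[|[|[|//]]]]]]] ?];
  rewrite /cone_basis /cone_dual /= ?pairingZr ?pairing_basis ?spcoord_lin ?spcoordZ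
    !spcoord_basis !bitset_eq /= !mxE /=
    ?(mul0r, mulr0, add0r, addr0, mulr1, mulVf) //.
Qed.

Section BaseChanged.
Variable A : comAlgType C.
Local Notation aA := (in_alg A a).
Local Notation cA := (in_alg A c).

Lemma cone_bitsE (y : 'rV[A]_7) p0 p1 p2 p3 p4 :
  spbits (y *m cone_mx%:A[A] : spinor A) p0 p1 p2 p3 p4 = cone_bits aA cA y p0 p1 p2 p3 p4.
Proof.
rewrite /spbits /spcoord mxE.
have E (k : 'I_7) S : cone_mx%:A[A] k (enum_rank S) = in_alg A (spcoord (cone_basis k) S).
  by rewrite !mxE.
under eq_bigr do rewrite E.
rewrite sum7E /cone_basis /= spcoord_lin !spcoordZ !spcoord_basis !bitset_eq.
case: p0; case: p1; case: p2; case: p3; case: p4;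
  rewrite /cone_bits /= ?(scale0r, scale1r, scaleNr, mulr0, mulr1, addr0, add0r) //;
  by rewrite mulrC.
Qed.

Lemma base_spinor_pairing (phi : spinor A) v : let f := spbits phi in
  pairing phi (clifford v (base_spinor%:A[A] : spinor A)) =
  aA * (v 0 (lshift 5 (o5 0)) * f true false false false false +
        v 0 (lshift 5 (o5 1)) * f false true false false false +
        v 0 (lshift 5 (o5 2)) * f false false true false false +
        v 0 (lshift 5 (o5 3)) * f false false false true false +
        v 0 (lshift 5 (o5 4)) * f false false false false true) +
  cA * (v 0 (rshift 5 (o5 0)) * f false true true true false -
        v 0 (rshift 5 (o5 1)) * f true false true true false +
        v 0 (rshift 5 (o5 2)) * f true true false true false -
        v 0 (rshift 5 (o5 3)) * f true true true false false +
        v 0 (lshift 5 (o5 4)) * f true true true true true).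
Proof.
move=> f; have -> : base_spinor%:A[A] =
    aA *: spbasis A (bitset false false false false false) +
    cA *: spbasis A (bitset true true true true false) :> spinor A.
  by rewrite map_mxD !map_mxZ !map_spbasis.
rewrite cliffordDr !cliffordZr pairingDr !pairingZr !pairing_clifford_bits /= -/f.
by rewrite ?expr0 ?expr1; ring.
Qed.

Lemma cone_section (y : 'rV[A]_7) : spinor_section base_spinor%:A[A] (y *m cone_mx%:A[A]) = 0.
Proof.
apply: polarV_inj => v; rewrite polarV0l spinor_sectionP base_spinor_pairing !cone_bitsE.
by rewrite /cone_bits /=; ring.
Qed.

Lemma in_alg_inj (b : C) x : b != 0 -> in_alg A b * x = 0 -> x = 0.
Proof.
move=> b0 bx; rewrite -[x]mul1r -(rmorph1 (in_alg A)) -(mulVf b0) rmorphM -mulrA bx.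
by rewrite mulr0.
Qed.

Lemma cone_section_bits (phi : spinor A) : let f := spbits phi in
  spinor_section base_spinor%:A[A] phi = 0 ->
  [/\ f true false false false false = 0, f false true false false false = 0,
      f false false true false false = 0, f false false false true false = 0 &
      [/\ f false true true true false = 0, f true false true true false = 0,
      f true true false true false = 0, f true true true false false = 0 &
      aA * f false false false false true = - cA * f true true true true true]].
Proof.
move=> f H.
have E v : pairing phi (clifford v (base_spinor%:A[A] : spinor A)) = 0.
  by rewrite -spinor_sectionP H polarV0l.
have El i := E (row_mx (delta_mx 0 i) 0); have Er i := E (row_mx 0 (delta_mx 0 i)).
have vE v w i : (row_mx v w : 'rV[A]_(5 + 5)) 0 (lshift 5 i) = v 0 i by rewrite row_mxEl.
have wE v w i : (row_mx v w : 'rV[A]_(5 + 5)) 0 (rshift 5 i) = w 0 i by rewrite row_mxEr.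
split; [apply: (in_alg_inj a0); rewrite -(El (o5 0))|
  apply: (in_alg_inj a0); rewrite -(El (o5 1))|
  apply: (in_alg_inj a0); rewrite -(El (o5 2))|
  apply: (in_alg_inj a0); rewrite -(El (o5 3))|
  split; [apply: (in_alg_inj c0); rewrite -(Er (o5 0))|
   apply: (in_alg_inj c0); rewrite -[RHS]oppr0 -(Er (o5 1))|
   apply: (in_alg_inj c0); rewrite -(Er (o5 2))|
   apply: (in_alg_inj c0); rewrite -[RHS]oppr0 -(Er (o5 3))|
   apply/eqP; rewrite -subr_eq0; apply/eqP; rewrite -(El (o5 4))]];
 rewrite base_spinor_pairing !(vE, wE) !mxE /= -/f; ring.
Qed.

Lemma cone_invE (phi : spinor A) : odd_spinor phi ->
  spinor_section base_spinor%:A[A] phi = 0 ->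
  phi *m cone_inv%:A[A] *m cone_mx%:A[A] = phi.
Proof.
move=> ophi /cone_section_bits [f1 f2 f3 f4 [f5 f6 f7 f8 f9]].
have yE k : (phi *m cone_inv%:A[A]) 0 k = pairing phi ((cone_dual k)%:A[A] : spinor A).
  by rewrite /pairing !mxE; apply: eq_bigr => l _; rewrite !mxE.
apply: spinorP => S; have [p0 [p1 [p2 [p3 [p4 ->]]]]] := bitsetP S.
rewrite -/(spbits _ p0 p1 p2 p3 p4) cone_bitsE -/(spbits _ p0 p1 p2 p3 p4).
have ev q0 q1 q2 q3 q4 : ~~ odd_bits q0 q1 q2 q3 q4 -> spbits phi q0 q1 q2 q3 q4 = 0.
  by move=> q; apply: ophi; rewrite odd_bitset.
have aK x : aA * (in_alg A a^-1 * x) = x.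
  by rewrite mulrA -rmorphM mulfV // rmorph1 mul1r.
case: p0; case: p1; case: p2; case: p3; case: p4;
  rewrite /cone_bits /= ?yE /cone_dual /= ?map_mxZ ?map_spbasis ?pairingZr ?pairing_basis
    ?aK ?f1 ?f2 ?f3 ?f4 ?f5 ?f6 ?f7 ?f8 //; try by rewrite ev.
by rewrite mulrCA -/(spbits phi true true true true true) -f9 mulrCA aK.
Qed.

Lemma cone_gramE (y : 'rV[A]_7) : qform cone_gram%:A[A] y =
  2 * cone_form aA cA y.
Proof.
rewrite /cone_form; set a' := in_alg A a; set c' := in_alg A c.
rewrite /qform mxE sum7E ![(_ *m _) _ _]mxE !sum7E !mxE /=.
have acE : (- (2 * a * c))%:A = - (2 * a' * c').
  by rewrite -[LHS]/(in_alg A _) rmorphN !rmorphM rmorph_nat.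
by rewrite acE !scaleNr !scale0r !scale1r; ring.
Qed.

Lemma cone_quadric (y : 'rV[A]_7) : qform cone_gram%:A[A] y = 0 <->
  forall t x : spinor A, even_spinor t -> even_spinor x ->
  pairing (y *m cone_mx%:A[A] : spinor A)
    (clifford (spinor_section t (y *m cone_mx%:A[A])) x) = 0.
Proof.
set phi : spinor A := y *m _; rewrite cone_gramE.
have fE : spbits phi = cone_bits aA cA y.
  by do 5! apply: functional_extensionality_dep => ?; apply: cone_bitsE.
split=> [/mulIn_alg q0 t x et ex|H].
  rewrite [t]spinor_sum_basis section_suml clifford_suml pairing_sumr big1 // => S _.
  have [oS|eS] := boolP (odd #|S|); first by rewrite et // mul0r.
  rewrite [x]spinor_sum_basis clifford_sumr pairing_sumr big1 ?mulr0 // => X _.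
  have [oX|eX] := boolP (odd #|X|); first by rewrite ex // mul0r.
  have [p0 [p1 [p2 [p3 [p4 ES]]]]] := bitsetP S; rewrite ES odd_bitset in eS *.
  have [t0 [t1 [t2 [t3 [t4 EX]]]]] := bitsetP X; rewrite EX odd_bitset in eX *.
  by rewrite clifford_section_bits fE clifford_form_cone ?mulr0.
have := H _ _ (even_basis A (_ : ~~ odd #|bitset false true true true true|))
  (even_basis A (_ : ~~ odd #|bitset true false false false true|)).
rewrite !odd_bitset => /(_ isT isT).
by rewrite clifford_section_bits fE clifford_form_cone_eq => ->; rewrite mulr0.
Qed.
End BaseChanged.

Lemma base_parametrization :
  quadric_parametrization base_spinor cone_gram cone_mx cone_inv.
Proof.
split=> [|A]; first exact: cone_mxK.
split=> [phi|y|y]; [exact: cone_invE| |exact: cone_quadric].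
split; last exact: cone_section.
move=> S; have [p0 [p1 [p2 [p3 [p4 ->]]]]] := bitsetP S; rewrite odd_bitset => eS.
rewrite -/(spbits _ p0 p1 p2 p3 p4) cone_bitsE /cone_bits.
by case: p0 p1 p2 p3 p4 eS => [] [] [] [] [].
Qed.
End BaseCase.

(* Elimination of coordinates by transvections *)
Local Close Scope classical_set_scope.

Lemma spcoord_wedge (A : comNzRingType) i (x : spinor A) S :
  spcoord (wedge i x) S = if i \in S then sgn_at A i S * spcoord x (toggle i S) else 0.
Proof. by rewrite spcoord_mk /toggle; case: ifP. Qed.

Lemma spcoord_contract (A : comNzRingType) i (x : spinor A) S :
  spcoord (contract i x) S = if i \in S then 0 else sgn_at A i S * spcoord x (toggle i S).
Proof. by rewrite spcoord_mk /toggle; case: ifP. Qed.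

Lemma wedge_bits (A : comNzRingType) i (x : spinor A) p0 p1 p2 p3 p4 :
  spbits (wedge i x) p0 p1 p2 p3 p4 = match val i with
  | 0%N => if p0 then spbits x (~~ p0) p1 p2 p3 p4 else 0
  | 1%N => if p1 then (-1) ^+ p0 * spbits x p0 (~~ p1) p2 p3 p4 else 0
  | 2%N => if p2 then (-1) ^+ p0 * (-1) ^+ p1 * spbits x p0 p1 (~~ p2) p3 p4 else 0
  | 3%N => if p3 then (-1) ^+ p0 * (-1) ^+ p1 * (-1) ^+ p2 *
           spbits x p0 p1 p2 (~~ p3) p4 else 0
  | _ => if p4 then (-1) ^+ p0 * (-1) ^+ p1 * (-1) ^+ p2 * (-1) ^+ p3 *
           spbits x p0 p1 p2 p3 (~~ p4) else 0
  end.
Proof.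
rewrite /spbits spcoord_wedge toggle_bitset sgn_at_prod big_mkcond.
case: i => -[|[|[|[|[|//]]]]] ?; rewrite !big_ord_recl big_ord0 /= !inE /= ?mul1r ?mulr1 //;
  by rewrite !mulrA.
Qed.

Section Reduction.
Variable C : numFieldType.
Implicit Types (s : spinor C) (S : {set 'I_5}).

Definition parametrizable s := exists G T T',
  [/\ G^T = G, G \in unitmx & quadric_parametrization s G T T'].

Lemma parametrizable_transv s u w : isotropic_pair u w ->
  parametrizable (transv u w s) -> parametrizable s.
Proof.
move=> uw [G [T [T' [GT Gu par]]]].
exists G, (T *m (transv_mx u w)^T), ((transv_mx (- u) w)^T *m T'); split=> //.
exact: parametrization_transv.
Qed.

Lemma quadV_e i : quadV (delta_mx 0 (lshift 5 i) : 'rV[C]_(5 + 5)) = 0.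
Proof. by rewrite /quadV big1 // => j _; rewrite !mxE eq_rlshift mulr0. Qed.

Lemma quadV_f i : quadV (delta_mx 0 (rshift 5 i) : 'rV[C]_(5 + 5)) = 0.
Proof. by rewrite /quadV big1 // => j _; rewrite !mxE eq_lrshift mul0r. Qed.

Lemma quadVZ (a : C) v : quadV (a *: v) = a ^+ 2 * quadV v.
Proof. by rewrite /quadV mulr_sumr; apply: eq_bigr => i _; rewrite !mxE; ring. Qed.

Lemma parametrizable_wedge s c i j :
  parametrizable (s + c *: wedge i (wedge j s)) -> parametrizable s.
Proof.
move=> H; apply: (@parametrizable_transv s (c *: delta_mx 0 (lshift 5 i))
  (delta_mx 0 (lshift 5 j))).
  split; rewrite ?quadVZ ?quadV_e ?mulr0 // polarVZl polarVE big1 ?mulr0 // => k _.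
  by rewrite !mxE !eq_rlshift !mulr0 addr0.
by rewrite /transv cliffordZl !clifford_e.
Qed.

Lemma parametrizable_contract s c i j : i != j ->
  parametrizable (s + c *: wedge i (contract j s)) -> parametrizable s.
Proof.
move=> ij H; apply: (@parametrizable_transv s (c *: delta_mx 0 (lshift 5 i))
  (delta_mx 0 (rshift 5 j))).
  split; rewrite ?quadVZ ?quadV_e ?quadV_f ?mulr0 // polarVZl polarVE big1 ?mulr0 // => k _.
  rewrite !mxE !eq_rlshift !eq_lrshift !mulr0 addr0 eq_lshift eq_rshift /=.
  by case: eqP => [->|]; rewrite ?(negPf ij) ?mulr0 ?mul0r.
by rewrite /transv cliffordZl clifford_e clifford_f.
Qed.

Lemma spcoordD_scale s c t S : spcoord (s + c *: t) S = spcoord s S + c * spcoord t S.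
Proof. by rewrite addrC spcoord_lin addrC. Qed.

Lemma odd_toggle i S : odd #|toggle i S| = ~~ odd #|S|.
Proof.
rewrite /toggle; case: ifP => iS; last by rewrite cardsU1 iS.
by rewrite [in RHS](cardsD1 i) iS /= negbK.
Qed.

Lemma even_wedge_wedge s c i j : even_spinor s -> even_spinor (s + c *: wedge i (wedge j s)).
Proof.
move=> es S oS; rewrite spcoordD_scale es // !spcoord_wedge add0r.
case: ifP => _; rewrite ?mulr0 //; case: ifP => _; rewrite ?mulr0 //.
by rewrite es ?mulr0 // !odd_toggle negbK.
Qed.

Lemma even_wedge_contract s c i j :
  even_spinor s -> even_spinor (s + c *: wedge i (contract j s)).
Proof.
move=> es S oS; rewrite spcoordD_scale es // spcoord_wedge spcoord_contract add0r.
case: ifP => _; rewrite ?mulr0 //; case: ifP => _; rewrite ?mulr0 //.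
by rewrite es ?mulr0 // !odd_toggle negbK.
Qed.

Lemma sgn_at_neq0 i S : sgn_at C i S != 0.
Proof. by rewrite signr_eq0. Qed.

Lemma card_bitset p0 p1 p2 p3 p4 : #|bitset p0 p1 p2 p3 p4| = (p0 + p1 + p2 + p3 + p4)%N.
Proof.
rewrite -sum1_card big_mkcond /= !big_ord_recl big_ord0 /= !inE /= addn0.
by case: p0 p1 p2 p3 p4 => [] [] [] [] [].
Qed.

Lemma bitset_setC1 :
  [/\ bitset false true true true true = [set~ o5 0],
      bitset true false true true true = [set~ o5 1],
      bitset true true false true true = [set~ o5 2],
      bitset true true true false true = [set~ o5 3] &
      bitset true true true true false = [set~ o5 4]].
Proof. by split; apply/setP => -[[|[|[|[|[|//]]]]] ?]; rewrite !inE -val_eqE. Qed.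

(* The transvection by [c e_5] and [f_j] makes the coordinate on the complement of
   [j] vanish, using the coordinate on {1, 2, 3, 4}. *)
Lemma parametrizable_quartic n s : even_spinor s ->
  spcoord s finset.set0 != 0 -> spcoord s [set~ o5 4] != 0 ->
  (forall S, #|S| = 2 -> spcoord s S = 0) ->
  (#|[set j | (j != o5 4) && (spcoord s [set~ j] != 0%R)]| <= n)%N -> parametrizable s.
Proof.
elim: n s => [|n IHn] s es s0 s4 s2.
  rewrite leqn0 cards_eq0 => /eqP Z0.
  have sC j : j != o5 4 -> spcoord s [set~ j] = 0.
    move=> j4; apply/eqP; apply: contraT => sj.
    by move/finset.setP/(_ j): Z0; rewrite !inE j4 sj.
  have -> : s = base_spinor (spcoord s finset.set0) (spcoord s [set~ o5 4]).
    have [E0 E1 E2 E3 E4] := bitset_setC1.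
    have E : finset.set0 = bitset false false false false false.
      by apply/setP => -[[|[|[|[|[|//]]]]] ?]; rewrite !inE.
    apply: spinorP => S; have [p0 [p1 [p2 [p3 [p4 ->]]]]] := bitsetP S.
    rewrite spcoord_lin spcoordZ !spcoord_basis !bitset_eq.
    case: p0; case: p1; case: p2; case: p3; case: p4;
      rewrite /= ?mulr0 ?mulr1 ?addr0 ?add0r //; rewrite ?E ?E4 //;
      first [by rewrite es // odd_bitset | by rewrite s2 // card_bitset |
             by rewrite ?E0 ?E1 ?E2 ?E3 sC].
  exists (cone_gram (spcoord s finset.set0) (spcoord s [set~ o5 4])).
  exists (cone_mx (spcoord s finset.set0) (spcoord s [set~ o5 4])).
  exists (cone_inv (spcoord s finset.set0)); split.
  - exact: antidiag_gram_tr.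
  - exact: cone_gram_unit.
  - exact: base_parametrization.
move=> Zn; have [Z0|[j]] := set_0Vmem [set j | (j != o5 4) && (spcoord s [set~ j] != 0%R)].
  by apply: IHn => //; rewrite Z0 cards0.
rewrite inE => /andP[j4 sj].
pose c := - spcoord s [set~ j] /
  (sgn_at C (o5 4) [set~ j] * sgn_at C j (toggle (o5 4) [set~ j]) * spcoord s [set~ o5 4]).
apply: (@parametrizable_contract s c (o5 4) j); first by rewrite eq_sym.
(* Only the coordinates on sets that contain 5 and omit j can change. *)
have coordE S : o5 4 \notin S \/ j \in S ->
    spcoord (s + c *: wedge (o5 4) (contract j s)) S = spcoord s S.
  rewrite spcoordD_scale spcoord_wedge spcoord_contract => H.
  case: ifP => S4; last by rewrite mulr0 addr0.
  have jS : j \in S by case: H; rewrite ?S4.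
  by rewrite /toggle S4 !inE j4 jS /= !mulr0 addr0.
have coordj : spcoord (s + c *: wedge (o5 4) (contract j s)) [set~ j] = 0.
  rewrite spcoordD_scale spcoord_wedge spcoord_contract !inE eq_sym j4 /=.
  have -> : (j \in toggle (o5 4) [set~ j]) = false.
    by rewrite /toggle !inE eq_sym j4 !inE eqxx andbF.
  have -> : toggle j (toggle (o5 4) [set~ j]) = [set~ o5 4].
    apply/setP => k; rewrite /toggle !inE (eq_sym _ j) j4 !inE eqxx andbF !inE.
    by have [->|] := eqVneq k j; rewrite ?j4 //= ?andbT.
  by rewrite (mulrA (sgn_at _ _ _)) divfK ?subrr // !mulf_neq0 ?sgn_at_neq0.
apply: IHn.
- exact: even_wedge_contract.
- by rewrite coordE // inE; left.
- by rewrite coordE // !inE eqxx; left.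
(* A pair {5, k} receives a multiple of the coordinate on {j, k}, which is again a pair. *)
- move=> S cS; have [S4|S4] := boolP (o5 4 \in S); last by rewrite coordE ?s2 //; left.
  have [Sj|Sj] := boolP (j \in S); first by rewrite coordE ?s2 //; right.
  rewrite spcoordD_scale spcoord_wedge spcoord_contract s2 // add0r.
  rewrite S4 {1}/toggle S4 !inE (negPf Sj) andbF s2 ?mulr0 //.
  rewrite /toggle S4 !inE (negPf Sj) andbF cardsU1 !inE (negPf Sj) andbF.
  by move: cS; rewrite (cardsD1 (o5 4)) S4.
- rewrite -ltnS; apply: leq_trans Zn; apply: proper_card; apply/properP; split.
    apply/fintype.subsetP => k; rewrite !inE => /andP[k4]; rewrite k4 /=.
    have [->|kj] := eqVneq k j; first by rewrite coordj eqxx.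
    by rewrite coordE //; right; rewrite !inE eq_sym.
  by exists j; rewrite inE ?j4 ?sj // coordj eqxx andbF.
Qed.

(* For [s] = a exp(omega) (1 + eta) with [omega], [eta] of degree 2, 4, this is [a ^ 2]
   times the coefficient of e_1 /\ e_2 /\ e_3 /\ e_4 in [eta]. *)
Definition discriminant s : C := let f := spbits s in
  f false false false false false * f true true true true false -
  f true true false false false * f false false true true false +
  f true false true false false * f false true false true false -
  f true false false true false * f false true true false false.

(** The transvection is multiplication by exp(c e_i /\ e_j): it adds c e_i /\ e_j to omega and
    leaves a and eta alone. *)
Lemma discriminant_wedge s c i j : i != j ->
  discriminant (s + c *: wedge i (wedge j s)) = discriminant s.
Proof.
have E p0 p1 p2 p3 p4 : spbits (s + c *: wedge i (wedge j s)) p0 p1 p2 p3 p4 =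
    spbits s p0 p1 p2 p3 p4 + c * spbits (wedge i (wedge j s)) p0 p1 p2 p3 p4.
  exact: spcoordD_scale.
rewrite /discriminant !E !wedge_bits.
case: i j {E} => [[|[|[|[|[|//]]]]] ?] [[|[|[|[|[|//]]]]] ?]; rewrite -val_eqE //= => _;
  rewrite ?expr0 ?expr1; ring.
Qed.

(* The transvection by [c e_i] and [e_j] makes the coordinate on {i, j} vanish,
   using the coordinate on the empty set. *)
Lemma parametrizable_general n s : even_spinor s ->
  spcoord s finset.set0 != 0 -> discriminant s != 0 ->
  (#|[set S : {set 'I_5} | (#|S| == 2) && (spcoord s S != 0%R)]| <= n)%N ->
  parametrizable s.
Proof.
have base t : even_spinor t -> spcoord t finset.set0 != 0 -> discriminant t != 0 ->
    [set S : {set 'I_5} | (#|S| == 2) && (spcoord t S != 0%R)] = finset.set0 ->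
    parametrizable t.
  move=> et t0 dt Z0.
  have t2 S : #|S| = 2 -> spcoord t S = 0.
    move=> cS; apply/eqP; apply: contraT => tS.
    by move/finset.setP/(_ S): Z0; rewrite !inE cS tS.
  apply: (@parametrizable_quartic _ t) (leqnn _) => //.
  (* Without its degree 2 part, the spinor has discriminant equal to the product of its coordinates
     on the empty set and on {1,2,3,4}; the latter is thus nonzero. *)
  apply: contraNneq dt; have [_ _ _ _ <-] := bitset_setC1 => t4.
  rewrite /discriminant /spbits t4 (t2 (bitset true true _ _ _)) ?card_bitset //.
  rewrite (t2 (bitset true false true _ _)) ?card_bitset //.
  by rewrite (t2 (bitset true false false _ _)) ?card_bitset // !mul0r mulr0 !(addr0, subr0).
elim: n s => [|n IHn] s es s0 ds Zn.
  by apply: base => //; apply/eqP; rewrite -cards_eq0 -leqn0.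
have [Z0|[S]] := set_0Vmem [set S : {set 'I_5} | (#|S| == 2) && (spcoord s S != 0%R)].
  exact: base.
rewrite inE => /andP[/cards2P[i [j [ij ES]]] sS]; rewrite {S}ES in sS.
pose c := - spcoord s [set i; j] /
  (sgn_at C i [set i; j] * sgn_at C j (toggle i [set i; j]) * spcoord s finset.set0).
apply: (@parametrizable_wedge s c i j).
have coordE S : ~~ ((i \in S) && (j \in S)) ->
    spcoord (s + c *: wedge i (wedge j s)) S = spcoord s S.
  rewrite spcoordD_scale !spcoord_wedge => H.
  case: ifP => Si; last by rewrite mulr0 addr0.
  have jS : j \in S = false by move: H; rewrite Si => /negPf.
  by rewrite /toggle Si !inE jS andbF !mulr0 addr0.
have coordij : spcoord (s + c *: wedge i (wedge j s)) [set i; j] = 0.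
  rewrite spcoordD_scale !spcoord_wedge !inE eqxx /=.
  have ti : toggle i [set i; j] = [set j].
    by rewrite /toggle !inE eqxx /= finset.setU1K // inE.
  have tj : toggle j [set j] = finset.set0 by rewrite /toggle !inE eqxx finset.setDv.
  rewrite ti tj inE eqxx /c ti.
  by rewrite (mulrA (sgn_at _ _ _)) divfK ?subrr // !mulf_neq0 ?sgn_at_neq0.
apply: IHn.
- exact: even_wedge_wedge.
- by rewrite coordE // inE.
- by rewrite discriminant_wedge.
- rewrite -ltnS; apply: leq_trans Zn; apply: proper_card; apply/properP; split.
    apply/fintype.subsetP => S; rewrite !inE => /andP[/[dup] S2 ->] /=.
    have [/andP[iS jS]|nS] := boolP ((i \in S) && (j \in S)); last by rewrite coordE.
    suff <- : [set i; j] = S by rewrite coordij eqxx.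
    apply/eqP; rewrite eqEcard (eqP S2) cards2 ij andbT.
    by apply/fintype.subsetP => k; rewrite !inE => /orP[] /eqP ->.
  by exists [set i; j]; rewrite inE ?cards2 ?ij ?sS // coordij eqxx andbF.
Qed.
End Reduction.

Lemma discriminant_base (C : numFieldType) (a c : C) : discriminant (base_spinor a c) = a * c.
Proof.
rewrite /discriminant /spbits /base_spinor !spcoord_lin !spcoordZ !spcoord_basis !bitset_eq /=.
by ring.
Qed.

Theorem proposition20 (R : realType) :
  general_even_spinor (fun s : spinor (complex R) =>
    forall G : 'M[complex R]_7, smooth_quadric G ->
      isomorphic (zero_locus s) (quadric G)).
Proof.
pose X p0 p1 p2 p3 p4 : {mpoly (complex R)[#|{: {set 'I_5}}|]} :=
  'X_(enum_rank (bitset p0 p1 p2 p3 p4)).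
(* The degree 0 coordinate times the discriminant, the two quantities that the elimination needs to
   be nonzero. Both are 1 at the spinor 1 + e_1 /\ e_2 /\ e_3 /\ e_4. *)
pose p := X false false false false false *
  (X false false false false false * X true true true true false -
   X true true false false false * X false false true true false +
   X true false true false false * X false true false true false -
   X true false false true false * X false true true false false).
have XE (s : spinor (complex R)) p0 p1 p2 p3 p4 :
    (X p0 p1 p2 p3 p4).@[fun k => s 0 k] = spbits s p0 p1 p2 p3 p4.
  exact: mevalXU.
have pE (s : spinor (complex R)) : p.@[fun k => s 0 k] =
    spbits s false false false false false * discriminant s.
  by rewrite /p /discriminant !(mevalM, mevalD, mevalN) !XE.
exists p; split.
  exists (base_spinor 1 1).
    move=> S oS; rewrite spcoord_lin spcoordZ !(even_basis (complex R)) ?mulr0 ?addr0 //;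
    by rewrite card_bitset.
  rewrite pE discriminant_base !mulr1 /spbits spcoord_lin spcoordZ !spcoord_basis.
  rewrite !bitset_eq /=.
  by rewrite !mulr0 mulr1 addr0 oner_neq0.
move=> s es; rewrite pE mulf_eq0 negb_or => /andP[s0 ds] G /smooth_quadric_unit[GT Gu].
have E0 : finset.set0 = bitset false false false false false.
  by apply/finset.setP => -[[|[|[|[|[|//]]]]] ?]; rewrite !inE.
have [|G0 [T [T' [G0T G0u par]]]] := @parametrizable_general _ _ s es _ ds (leqnn _).
  by rewrite E0.
have [P Pu <-] := symmetric_congruent G0T G0u GT Gu.
exact: zero_locus_isomorphic (parametrization_congr Pu par).
Qed.
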